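(* Consider $\min_x f(x)+\sum_{i=1}^Mg_i(x_i)$ s.t. $Ax:=\sum_{i=1}^MA_ix_i=b$ with $A\ne0$, where $f$ is convex and differentiable, each $g_i$ is proper closed convex, $g(x)=\sum_ig_i(x_i)$ is strongly convex with modulus $\mu>0$, for every $S\subset\{1,\dots,M\}$ with $|S|=m$ the partial gradient $\nabla_Sf$ is Lipschitz continuous with a uniform constant $L_m$, and there exists a KKT point $(x^*,\lambda^* )$. Put $\theta=m/M$, let $t\ge2$ be the total number of iterations, let $\rho\ge1$ be a constant, $k_0=\frac4\theta+\frac{2L_m}{\theta\mu}$, and let $\{(x^k,\lambda^k)\}$ be generated by the accelerated randomized primal-dual block coordinate update method (see context) with parameters $$\beta_k=\frac{\mu(\theta k+2+\theta)}{2\rho\|A\|_2^2},\quad \eta_k=\rho\beta_k\|A\|_2^2+L_m,\quad k\ge1,$$ $$\rho_k=\frac{\theta\beta_k}{6-5\theta}\ \text{ for }1\le k\le t-1,\qquad \rho_t=\frac{(t+k_0+1)\rho_{t-1}}{\theta(t+k_0+1)-1}.$$ Let $\gamma=\max\{2\|\lambda^*\|,1+\|\lambda^*\|\}$, $$T=(t+k_0+1)+\sum_{k=2}^t\big(\theta(k+k_0+1)-1\big),\qquad \bar x^{t+1}=\frac{(t+k_0+1)x^{t+1}+\sum_{k=2}^t\big(\theta(k+k_0+1)-1\big)x^k}{T},$$ $$\phi_3(x,\lambda)=(1-\theta)(k_0+2)\Big[F(x^1)-F(x)+\beta_1\|r^1\|^2+\frac\mu2\|x^1-x\|^2\Big]+\frac{\eta_1(k_0+2)}2\|x^1-x\|^2+\frac{\theta(k_0+3)-1}{2\rho_1}\|\lambda\|^2.$$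 Then $$\big|\mathbb E[F(\bar x^{t+1})-F(x^* )]\big|\le\frac1T\max_{\|\lambda\|\le\gamma}\phi_3(x^*,\lambda),\qquad \mathbb E\|A\bar x^{t+1}-b\|\le\frac{1}{T\max\{1,\|\lambda^*\|\}}\max_{\|\lambda\|\le\gamma}\phi_3(x^*,\lambda).$$ In addition, $$\mathbb E\|x^{t+1}-x^*\|^2\le\frac{2\phi_3(x^*,\lambda^* )}{(t+k_0+1)\left(\frac{(\rho-1)\mu}{2\rho}(\theta t+\theta+2)+2\mu+L_m\right)}.$$
   Context: The variable $x=(x_1,\dots,x_M)$ is partitioned into $M$ disjoint blocks and $A=[A_1,\dots,A_M]$; $\|A\|_2$ is the spectral norm. $g_i$ may be extended-valued. $F=f+g$. $\nabla_Sf$ is the gradient with respect to the blocks indexed by $S$. A point $(x^*,\lambda^* )$ is a KKT point if $0\in\partial F(x^* )-A^\top\lambda^*$ and $Ax^*=b$. If $F(x^1)=+\infty$ bounds are read in the extended sense, with $0\cdot\infty=0$. Accelerated randomized primal-dual block coordinate update method: choose a (deterministic) $x^1$, set $\lambda^1=0$, $r^1=Ax^1-b$, and an integer $1\le m\le M$. For $k=1,2,\dots$, select $S_k\subset\{1,\dots,M\}$ with $|S_k|=m$ uniformly at random (independently of the past), and with scalar parameters $\beta_k,\rho_k,\eta_k$ do $$x_i^{k+1}=\arg\min_{x_i}\langle\nabla_if(x^k)-A_i^\top(\lambda^k-\beta_kr^k),x_i\rangle+g_i(x_i)+\tfrac{\eta_k}2\|x_i-x_i^k\|^2\ \text{ if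 }i\in S_k,\qquad x_i^{k+1}=x_i^k\ \text{ if }i\notin S_k,$$ $$r^{k+1}=r^k+\sum_{i\in S_k}A_i(x_i^{k+1}-x_i^k),\qquad \lambda^{k+1}=\lambda^k-\rho_kr^{k+1}.$$ Expectation is over all random choices of the sets $S_k$. *)

(* Defs.v *)
From HB Require Import structures.
From mathcomp Require Import all_boot all_order all_algebra.
From mathcomp Require Import all_classical all_reals all_analysis.

Set Implicit Arguments.
Unset Strict Implicit.
Unset Printing Implicit Defensive.

Import Order.TTheory GRing.Theory Num.Theory.
Import numFieldNormedType.Exports.

Local Open Scope classical_set_scope.
Local Open Scope ring_scope.

Section Euclidean.
Context {R : realType}.

Definition dotp n (u v : 'cV[R]_n) : R := \sum_i u i 0 * v i 0.

(* The library norm `|v| on matrices is the max norm. *)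
Definition l2norm n (v : 'cV[R]_n) : R := Num.sqrt (dotp v v).

Definition spectral_norm q n (A : 'M[R]_(q, n)) : R :=
  sup [set l2norm (A *m v) | v in [set v | l2norm v <= 1]].

Definition grad n (f : 'cV[R]_n -> R) (x : 'cV[R]_n) : 'cV[R]_n :=
  \col_j 'D_(delta_mx j 0) (f : _ -> R^o) x.

End Euclidean.

Section ExtendedValued.
Context {R : realType}.
Local Open Scope ereal_scope.

Definition proper_fun n (h : 'cV[R]_n -> \bar R) :=
  (forall x, h x != -oo) /\ exists x, h x != +oo.

Definition strongly_convex_efun n (mu : R) (h : 'cV[R]_n -> \bar R) :=
  forall (x y : 'cV[R]_n) (s : R), (0 <= s <= 1)%R ->
    h (s *: x + (1 - s) *: y)%R <=
    s%:E * h x + (1 - s)%:E * h y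
    - (mu / 2 * (s * (1 - s)) * l2norm (x - y) ^+ 2)%:E.

Definition convex_efun n (h : 'cV[R]_n -> \bar R) :=
  forall (x y : 'cV[R]_n) (s : R), (0 <= s <= 1)%R ->
    h (s *: x + (1 - s) *: y)%R <= s%:E * h x + (1 - s)%:E * h y.

Definition subdiff n (h : 'cV[R]_n -> \bar R) (x : 'cV[R]_n) :
    set 'cV[R]_n :=
  [set v | forall y, h x + (dotp v (y - x))%:E <= h y].

Definition is_argmin n (h : 'cV[R]_n -> \bar R) (u : 'cV[R]_n) :=
  forall v, h u <= h v.

End ExtendedValued.

Section Blocks.
Context {R : realType} (M : nat) (p_ : 'I_M -> nat).
Local Notation N := (\sum_i p_ i)%N.
Implicit Types (x v : 'cV[R]_N) (S : {set 'I_M}).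

Definition block_restr S v : 'cV[R]_N :=
  \mxcol_i (if i \in S then submxcol v i else 0).

(* The gradient with respect to the blocks in S, padded with zeros outside S
   so that its type does not depend on S; this does not change its norm. *)
Definition partial_grad (f : 'cV[R]_N -> R) S x : 'cV[R]_N :=
  block_restr S (grad f x).

(* Lipschitz continuity in the variables x_i, i \in S, the other blocks being
   held fixed; it is implied by Lipschitz continuity in the whole of x. *)
Definition partial_grad_lipschitz (f : 'cV[R]_N -> R) S (L : R) :=
  forall x v,
    l2norm (partial_grad f S (x + block_restr S v) - partial_grad f S x)
    <= L * l2norm (block_restr S v).

Definition separable_sum (g : forall i, 'cV[R]_(p_ i) -> \bar R) x : \bar R :=
  (\sum_i g i (submxcol x i))%E.

Definition objective (f : 'cV[R]_N -> R)
    (g : forall i, 'cV[R]_(p_ i) -> \bar R) x : \bar R :=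
  ((f x)%:E + separable_sum g x)%E.

Definition kkt_point q (F : 'cV[R]_N -> \bar R) (A : 'M[R]_(q, N))
    (b : 'cV[R]_q) x (lam : 'cV[R]_q) :=
  (exists2 v, subdiff F x v & 0 = v - A^T *m lam) /\ A *m x = b.

Section Method.
Context {q : nat} (f : 'cV[R]_N -> R)
  (g : forall i, 'cV[R]_(p_ i) -> \bar R)
  (A_ : forall i, 'M[R]_(q, p_ i)) (b : 'cV[R]_q).

Definition block_objective (beta eta : R) x (lam r : 'cV[R]_q) (i : 'I_M)
    (u : 'cV[R]_(p_ i)) : \bar R :=
  ((dotp (submxcol (grad f x) i - (A_ i)^T *m (lam - beta *: r)) u)%:E
   + g u + (eta / 2 * l2norm (u - submxcol x i) ^+ 2)%:E)%E.

Definition primal_dual_bcu (beta rho eta : nat -> R) (x1 : 'cV[R]_N) (t : nat)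
    (S : nat -> {set 'I_M}) (x : nat -> 'cV[R]_N) (lam r : nat -> 'cV[R]_q) :=
  [/\ x 1%N = x1, lam 1%N = 0, r 1%N = (\mxrow_i A_ i) *m x1 - b &
    forall k, (1 <= k <= t)%N ->
    [/\ forall i, i \in S k ->
          is_argmin (@block_objective (beta k) (eta k) (x k) (lam k) (r k) i)
            (submxcol (x k.+1) i),
        forall i, i \notin S k -> submxcol (x k.+1) i = submxcol (x k) i,
        r k.+1 = r k + \sum_(i in S k)
          A_ i *m (submxcol (x k.+1) i - submxcol (x k) i) &
        lam k.+1 = lam k - rho k *: r k.+1]].

End Method.
End Blocks.

Section Sampling.
Context {R : realType} d (Omega : measurableType d) (P : probability Omega R).
Local Open Scope ereal_scope.

(* S_1, ..., S_t are random m-element subsets of {1, ..., M}; each S_k is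
   uniform, and independent of (S_1, ..., S_(k-1)).  As the S_k take finitely
   many values, independence is tested on the atoms of the past. *)
Definition uniform_sampling (M m t : nat) (S : nat -> Omega -> {set 'I_M}) :=
  forall k, (1 <= k <= t)%N ->
  [/\ forall w, #|S k w| = m,
      forall s : {set 'I_M}, measurable [set w | S k w = s],
      forall s : {set 'I_M}, #|s| = m -> P [set w | S k w = s] = ('C(M, m)%:R^-1)%:E &
      forall (s : {set 'I_M}) (h : nat -> {set 'I_M}),
        P [set w | S k w = s /\ forall j, (1 <= j < k)%N -> S j w = h j]
        = P [set w | S k w = s]
          * P [set w | forall j, (1 <= j < k)%N -> S j w = h j]].

End Sampling.

Definition phi3 {R : realType} n q (F : 'cV[R]_n -> \bar R)
    (theta k0 mu beta1 eta1 rho1 : R) (x1 : 'cV[R]_n) (r1 : 'cV[R]_q)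
    (x : 'cV[R]_n) (lam : 'cV[R]_q) : \bar R :=
  (((1 - theta) * (k0 + 2))%:E
     * (F x1 - F x + (beta1 * l2norm r1 ^+ 2)%:E
        + (mu / 2 * l2norm (x1 - x) ^+ 2)%:E)
   + (eta1 * (k0 + 2) / 2 * l2norm (x1 - x) ^+ 2)%:E
   + ((theta * (k0 + 3) - 1) / (2 * rho1) * l2norm lam ^+ 2)%:E)%E.

(* Main.v *)
(* Adding the optimality conditions of the selected block subproblems, the descent
   lemma for f and the convexity of f bounds, along every trajectory, the progress
   of one iteration by a telescoping quantity plus a deviation: the contribution of
   the selected blocks minus theta times the contribution of all blocks.  The
   contributions only depend on the past, so the deviation has mean zero.  The
   parameters are such that, with weights c_k = k + k0 + 1 and an arbitrary
   multiplier l, the potential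
     c_k (1 - theta) (F(x^k) - F(xs) + mu/2 |x^k - xs|^2 - <lam^k, r^k>)
     + c_k (1/2 - theta) beta_k |r^k|^2 + c_k eta_k / 2 |x^k - xs|^2
     + d_k |lam^k - l|^2
   decreases by the weighted Lagrangian gap of x^(k+1) at l.  As this holds along
   every trajectory, l may be random, and Jensen's inequality transfers the bound
   to the averaged iterate.  The choices l = 0, l = - gamma r / |r| (with r the
   residual of the averaged iterate) and l = ls yield the three estimates. *)
Require Import Defs.
From HB Require Import structures.
From mathcomp Require Import all_boot all_order all_algebra.
From mathcomp Require Import all_classical all_reals all_analysis.
From mathcomp Require Import ring lra.

Set Implicit Arguments.
Unset Strict Implicit.
Unset Printing Implicit Defensive.

Import Order.TTheory GRing.Theory Num.Theory.
Import numFieldNormedType.Exports.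

Local Open Scope classical_set_scope.
Local Open Scope ring_scope.

(** * Euclidean and spectral norms *)

Section Dotp.
Context {R : realType}.
Implicit Types (n : nat).

Lemma dotpC n (u v : 'cV[R]_n) : dotp u v = dotp v u.
Proof. by apply: eq_bigr => i _; rewrite mulrC. Qed.

Lemma dotpDl n (u v w : 'cV[R]_n) : dotp (u + v) w = dotp u w + dotp v w.
Proof. by rewrite -big_split; apply: eq_bigr => i _; rewrite mxE mulrDl. Qed.

Lemma dotpZl n a (u v : 'cV[R]_n) : dotp (a *: u) v = a * dotp u v.
Proof. by rewrite mulr_sumr; apply: eq_bigr => i _; rewrite mxE mulrA. Qed.

Lemma dotpNl n (u v : 'cV[R]_n) : dotp (- u) v = - dotp u v.
Proof. by rewrite -scaleN1r dotpZl mulN1r. Qed.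

Lemma dotpDr n (u v w : 'cV[R]_n) : dotp w (u + v) = dotp w u + dotp w v.
Proof. by rewrite !(dotpC w) dotpDl. Qed.

Lemma dotpZr n a (u v : 'cV[R]_n) : dotp v (a *: u) = a * dotp v u.
Proof. by rewrite !(dotpC v) dotpZl. Qed.

Lemma dotpNr n (u v : 'cV[R]_n) : dotp v (- u) = - dotp v u.
Proof. by rewrite !(dotpC v) dotpNl. Qed.

Definition dotpE := (dotpDl, dotpDr, dotpNl, dotpNr, dotpZl, dotpZr).

Lemma dotp0l n (v : 'cV[R]_n) : dotp 0 v = 0.
Proof. by rewrite -(scale0r v) dotpZl mul0r. Qed.

Lemma dotp0r n (v : 'cV[R]_n) : dotp v 0 = 0.
Proof. by rewrite dotpC dotp0l. Qed.

Lemma dotp_suml n (I : Type) (s : seq I) (Q : pred I) (u : I -> 'cV[R]_n) v :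
  dotp (\sum_(i <- s | Q i) u i) v = \sum_(i <- s | Q i) dotp (u i) v.
Proof.
by elim/big_rec2: _ => [|i a b _ <-]; rewrite ?dotp0l ?dotpDl.
Qed.

Lemma dotp_sumr n (I : Type) (s : seq I) (Q : pred I) (u : I -> 'cV[R]_n) v :
  dotp v (\sum_(i <- s | Q i) u i) = \sum_(i <- s | Q i) dotp v (u i).
Proof. by rewrite dotpC dotp_suml; apply: eq_bigr => i _; rewrite dotpC. Qed.

Lemma dotp_trmx k n (B : 'M[R]_(k, n)) u v : dotp (B^T *m u) v = dotp u (B *m v).
Proof.
have dE l (a c : 'cV[R]_l) : dotp a c = (a^T *m c) 0 0.
  by rewrite mxE; apply: eq_bigr => i _; rewrite mxE.
by rewrite !dE trmx_mul trmxK mulmxA.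
Qed.

Lemma dotp_ge0 n (v : 'cV[R]_n) : 0 <= dotp v v.
Proof. by apply: sumr_ge0 => i _; rewrite -expr2 sqr_ge0. Qed.

Lemma dotp_eq0 n (v : 'cV[R]_n) : (dotp v v == 0) = (v == 0).
Proof.
apply/eqP/eqP => [v0|->]; last exact: dotp0l.
apply/colP => i; rewrite mxE; apply/eqP; rewrite -sqrf_eq0 expr2.
by move/psumr_eq0P: v0 => ->// j _; rewrite -expr2 sqr_ge0.
Qed.

Lemma l2norm_ge0 n (v : 'cV[R]_n) : 0 <= l2norm v.
Proof. exact: sqrtr_ge0. Qed.

Lemma sqr_l2norm n (v : 'cV[R]_n) : l2norm v ^+ 2 = dotp v v.
Proof. by rewrite sqr_sqrtr ?dotp_ge0. Qed.

Lemma l2norm_eq0 n (v : 'cV[R]_n) : (l2norm v == 0) = (v == 0).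
Proof. by rewrite -sqrf_eq0 sqr_l2norm dotp_eq0. Qed.

Lemma l2norm0 n : l2norm (0 : 'cV[R]_n) = 0.
Proof. by apply/eqP; rewrite l2norm_eq0. Qed.

Lemma l2normZ n a (v : 'cV[R]_n) : l2norm (a *: v) = `|a| * l2norm v.
Proof. by rewrite /l2norm !dotpE mulrA -expr2 sqrtrM ?sqr_ge0// sqrtr_sqr. Qed.

Lemma dotp_le n (u v : 'cV[R]_n) : dotp u v <= l2norm u * l2norm v.
Proof.
have [->|v0] := eqVneq v 0; first by rewrite dotp0r l2norm0 mulr0.
have vv : 0 < dotp v v by rewrite lt_def dotp_eq0 v0 dotp_ge0.
apply: (le_trans (ler_norm _)).
rewrite -(ler_pXn2r (n := 2)) ?nnegrE ?mulr_ge0 ?l2norm_ge0 ?normr_ge0//.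
rewrite exprMn !sqr_l2norm real_normK ?num_real//.
have := dotp_ge0 (dotp v v *: u - dotp u v *: v).
rewrite !dotpE (dotpC v u) => h.
have {h} : 0 <= dotp v v * (dotp u u * dotp v v - dotp u v ^+ 2).
  by apply: (le_trans h); rewrite le_eqVlt; apply/orP; left; apply/eqP; ring.
by rewrite pmulr_rge0// subr_ge0.
Qed.

Lemma abs_dotp_le n (u v : 'cV[R]_n) : `|dotp u v| <= l2norm u * l2norm v.
Proof.
rewrite ler_norml dotp_le andbT lerNl -dotpNl.
by apply: (le_trans (dotp_le _ _)); rewrite -scaleN1r l2normZ normrN normr1 mul1r.
Qed.

Lemma l2normD n (u v : 'cV[R]_n) : l2norm (u + v) <= l2norm u + l2norm v.
Proof.
rewrite -(ler_pXn2r (n := 2)) ?nnegrE ?addr_ge0 ?l2norm_ge0//.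
rewrite sqrrD !sqr_l2norm !dotpE (dotpC v u) mulr2n.
by have := dotp_le u v; lra.
Qed.

Lemma l2norm_sum n (I : Type) (s : seq I) (Q : pred I) (u : I -> 'cV[R]_n) :
  l2norm (\sum_(i <- s | Q i) u i) <= \sum_(i <- s | Q i) l2norm (u i).
Proof.
elim/big_rec2: _ => [|i a b _ h]; first by rewrite l2norm0.
by apply: (le_trans (l2normD _ _)); rewrite lerD2l.
Qed.

End Dotp.

Section SpectralNorm.
Context {R : realType} (q n : nat) (A : 'M[R]_(q, n)).

Lemma mulmx_col_sum (v : 'cV[R]_n) : A *m v = \sum_j v j 0 *: col j A.
Proof.
by apply/colP => i; rewrite mxE summxE; apply: eq_bigr => j _; rewrite !mxE mulrC.
Qed.

(** On the unit ball every coordinate of v is at most 1 in absolute value, so the column norms add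
    up to a bound. This makes the [sup] in [spectral_norm] a genuine supremum. *)
Lemma spectral_norm_has_sup :
  has_sup [set l2norm (A *m v) | v in [set v : 'cV[R]_n | l2norm v <= 1]].
Proof.
split; first by exists (l2norm (A *m 0)); exists 0 => //=; rewrite l2norm0 ler01.
exists (\sum_j l2norm (col j A)) => _ [v /= v1 <-].
rewrite mulmx_col_sum; apply: (le_trans (l2norm_sum _ _ _)).
apply: ler_sum => j _; rewrite l2normZ ler_piMl ?l2norm_ge0//.
rewrite -(ler_pXn2r (n := 2)) ?nnegrE// real_normK ?num_real// expr1n.
apply: (@le_trans _ _ (dotp v v)).
  by rewrite /dotp (bigD1 j)//= expr2 lerDl sumr_ge0// => i _; rewrite -expr2 sqr_ge0.
by rewrite -sqr_l2norm expr_le1 ?l2norm_ge0.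
Qed.

Lemma l2norm_mulmx_le (v : 'cV[R]_n) :
  l2norm (A *m v) <= spectral_norm A * l2norm v.
Proof.
have [->|v0] := eqVneq v 0; first by rewrite mulmx0 !l2norm0 mulr0.
have nv : 0 < l2norm v by rewrite lt_def l2norm_eq0 v0 l2norm_ge0.
rewrite -ler_pdivrMr// mulrC -[X in X * _]gtr0_norm ?invr_gt0// -l2normZ scalemxAr.
apply: ub_le_sup; first by case: spectral_norm_has_sup.
by exists ((l2norm v)^-1 *: v) => //=; rewrite l2normZ gtr0_norm ?invr_gt0// mulVf ?gt_eqF.
Qed.

Lemma dotp_mulmx_le (v : 'cV[R]_n) :
  dotp (A *m v) (A *m v) <= spectral_norm A ^+ 2 * dotp v v.
Proof.
rewrite -!sqr_l2norm -exprMn ler_pXn2r ?nnegrE ?l2norm_ge0 ?l2norm_mulmx_le//.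
exact: le_trans (l2norm_ge0 _) (l2norm_mulmx_le _).
Qed.

Lemma spectral_norm_gt0 : A != 0 -> 0 < spectral_norm A.
Proof.
move=> A0; rewrite ltNge; apply/negP => sA; move/negP: A0; apply.
apply/eqP/matrixP => i j; rewrite mxE.
have : l2norm (A *m delta_mx j 0) <= 0.
  by apply: (le_trans (l2norm_mulmx_le _)); rewrite mulr_le0_ge0 ?l2norm_ge0.
rewrite le_eqVlt ltNge l2norm_ge0 orbF l2norm_eq0 -colE => /eqP/colP/(_ i).
by rewrite !mxE.
Qed.

End SpectralNorm.

(** * Gradients of differentiable convex functions *)

Lemma convex_functionE {R : realType} n (f : 'cV[R]_n -> R) (x y : 'cV[R]_n) (s : R) :
  @convex_function R 'cV[R]_n setT f -> 0 <= s <= 1 ->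
  f (s *: x + (1 - s) *: y) <= s * f x + (1 - s) * f y.
Proof.
move=> cvxf /andP[s0 s1].
by have := cvxf (Itv01 s0 s1) x y; rewrite !inE => /(_ I I).
Qed.

Section Gradient.
Context {R : realType} (n : nat) (f : 'cV[R]_n -> R).
Hypothesis f_diff : forall z, differentiable (f : _ -> R^o) z.

Lemma derive_grad (x v : 'cV[R]_n) : 'D_v (f : _ -> R^o) x = dotp (grad f x) v.
Proof.
rewrite deriveE//.
have {1}-> : v = \sum_j v j 0 *: delta_mx j 0.
  apply/colP => i; rewrite summxE (bigD1 i)//= big1 => [|j ji].
    by rewrite !mxE !eqxx mulr1 addr0.
  by rewrite !mxE eq_sym (negPf ji) mulr0.
rewrite linear_sum; apply: eq_bigr => j _.
by rewrite linearZ/= mxE deriveE// mulrC.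
Qed.

Lemma is_derive_line (x v : 'cV[R]_n) (s : R) :
  is_derive s 1 (fun a : R => f (a *: v + x) : R^o) (dotp (grad f (s *: v + x)) v).
Proof.
have h (a : R) : (s + a) *: v + x = a *: v + (s *: v + x).
  by rewrite scalerDl (addrC (s *: v)) addrA.
have fl : derivable (f : _ -> R^o) (s *: v + x) v by exact: diff_derivable.
have E : (fun a : R => a^-1 *: ((fun a : R => f (a *: v + x) : R^o) (a *: 1 + s)
            - (f (s *: v + x) : R^o)))
       = (fun a : R => a^-1 *: ((f : _ -> R^o) (a *: v + (s *: v + x)) - f (s *: v + x))).
  by apply/funext => a; rewrite -h (addrC s) [a *: 1]mulr1.
apply: DeriveDef.
  by rewrite /derivable /= E.
by rewrite -derive_grad /derive /= E.
Qed.

(** Convexity bounds the difference quotients by [f y - f x] for steps in (0, 1), so the derivative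
    is taken as a limit from the right. *)
Lemma convex_grad (x y : 'cV[R]_n) :
  @convex_function R 'cV[R]_n setT f -> f x + dotp (grad f x) (y - x) <= f y.
Proof.
move=> cvxf; rewrite -lerBrDl -derive_grad.
have fl : derivable (f : _ -> R^o) x (y - x) by exact: diff_derivable.
rewrite /derive cvg_at_rightE//; apply: limr_le.
  by move: fl => /cvg_ex[l fl]; apply/cvg_ex; exists l; apply: cvg_dnbhs_at_right.
near=> a.
have a0 : 0 < a by near: a; exact: nbhs_right_gt.
have a1 : a < 1 by near: a; exact: nbhs_right_lt.
rewrite -[_ *: _]/(_ * _) mulrC ler_pdivrMr//.
have a01 : 0 <= a <= 1 by rewrite !ltW.
have := convex_functionE y x cvxf a01.
have -> : a *: y + (1 - a) *: x = a *: (y - x) + x.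
  by rewrite scalerBl scale1r scalerBr -addrA (addrC x) addrA.
by move=> /=; lra.
Unshelve. all: by end_near. Qed.

(** Mean value theorem for [psi], the error of the quadratic model along the line. The hypothesis
    concerns the single direction [v], so a bound on the blocks moved by [v] suffices. *)
Lemma descent (x v : 'cV[R]_n) (L : R) :
  (forall s : R, 0 <= s ->
    dotp (grad f (s *: v + x) - grad f x) v <= L * s * dotp v v) ->
  f (x + v) <= f x + dotp (grad f x) v + L / 2 * dotp v v.
Proof.
move=> lip.
pose psi (s : R) : R := f (s *: v + x) - s * dotp (grad f x) v
  - s ^+ 2 * (L / 2 * dotp v v).
pose dpsi (s : R) : R := dotp (grad f (s *: v + x)) v - dotp (grad f x) v
  - (s *+ 2) * (L / 2 * dotp v v).
have der (s : R) : is_derive s (1 : R) psi (dpsi s).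
  have h : is_derive s (1 : R) (fun a : R => f (a *: v + x)) (dotp (grad f (s *: v + x)) v) := is_derive_line x v s.
  rewrite /psi /dpsi; apply: is_derive_eq.
  by rewrite /GRing.scale/=; ring.
have cont : {within `[0, 1], continuous psi}.
  apply: derivable_within_continuous => s _; exact: ex_derive.
have [c c01] := MVT ltr01 (fun s _ => der s) cont.
rewrite subr0 mulr1 => E.
have c0 : 0 <= c by move: c01; rewrite in_itv/= => /andP[/ltW].
have : dpsi c <= 0.
  by have := lip _ c0; rewrite /dpsi !dotpE mulr2n; lra.
rewrite -E /psi scale1r scale0r add0r (addrC v) !mul0r !mul1r expr0n expr1n mul0r mul1r.
lra.
Qed.

End Gradient.

(** * Block updates *)

Lemma quadratic_growth {R : realType} (a b c : R) : 0 <= c ->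
  (forall s, 0 < s < 1 -> a <= s * b + (1 - s) * a - s * (1 - s) * c) ->
  a + c <= b.
Proof.
move=> c0 H; rewrite leNgt; apply/negP => abc.
pose e := a + c - b; have e0 : 0 < e by rewrite /e; lra.
(* Replaces the limit s -> 0: this value gives [s * c < e], so that
   [b - a - (1 - s) * c = s * c - e] is negative. *)
pose s := e / (2 * (c + e)).
have ce0 : 0 < 2 * (c + e) by lra.
have s0 : 0 < s by rewrite divr_gt0.
have s1 : s < 1 by rewrite ltr_pdivrMr// mul1r; lra.
have sE : s * (2 * (c + e)) = e by rewrite /s divfK// gt_eqF.
have := H s; rewrite s0 s1 => /(_ isT) h.
have : 0 <= s * (b - a - (1 - s) * c) by move: h; nra.
rewrite pmulr_rge0// => h1.
have : s * c < e by have := mulr_gt0 s0 e0; nra.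
by rewrite /e in h1 *; nra.
Qed.

Lemma dotp_convex_comb {R : realType} n (s : R) (u v w : 'cV[R]_n) :
  dotp (s *: u + (1 - s) *: v - w) (s *: u + (1 - s) *: v - w) =
  s * dotp (u - w) (u - w) + (1 - s) * dotp (v - w) (v - w)
  - s * (1 - s) * dotp (u - v) (u - v).
Proof. by rewrite !dotpE (dotpC v u) (dotpC w u) (dotpC w v); ring. Qed.

Section BlockVectors.
Context {R : realType} (M : nat) (p_ : 'I_M -> nat).
Local Notation N := (\sum_i p_ i)%N.
Implicit Types (x v u : 'cV[R]_N) (S : {set 'I_M}).

Lemma dotp_submxcol u v : dotp u v = \sum_i dotp (submxcol u i) (submxcol v i).
Proof.
have dE l (a c : 'cV[R]_l) : dotp a c = (a^T *m c) 0 0.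
  by rewrite mxE; apply: eq_bigr => i _; rewrite mxE.
rewrite dE -{1}(submxcolK u) -{1}(submxcolK v) tr_mxcol mul_mxrow_mxcol summxE.
by apply: eq_bigr => i _; rewrite dE.
Qed.

Lemma submxcolZ a v i : submxcol (a *: v) i = a *: submxcol v i.
Proof. by apply/matrixP => j k; rewrite !mxE. Qed.

Lemma submxcol_block_restr S v i :
  submxcol (block_restr S v) i = if i \in S then submxcol v i else 0.
Proof. by rewrite mxcolK. Qed.

Lemma block_restr_id S v :
  (forall i, i \notin S -> submxcol v i = 0) -> block_restr S v = v.
Proof.
move=> v0; apply/mxcolP => i; rewrite submxcol_block_restr.
by case: ifPn => // /v0 ->.
Qed.

Lemma dotp_block_restr S u v :
  dotp (block_restr S u) v = dotp u (block_restr S v).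
Proof.
rewrite !dotp_submxcol; apply: eq_bigr => i _; rewrite !submxcol_block_restr.
by case: ifP; rewrite ?dotp0l ?dotp0r.
Qed.

Lemma block_restrB S u v :
  block_restr S (u - v) = block_restr S u - block_restr S v.
Proof.
apply/mxcolP => i; rewrite !submxcolB !submxcol_block_restr.
by case: ifP; rewrite ?submxcolB ?subr0.
Qed.

(** The displacement lives on S and restriction to S is self-adjoint, so only the partial gradient
    is tested against it. *)
Lemma descent_block (f : 'cV[R]_N -> R) S L x v :
  (forall z, differentiable (f : _ -> R^o) z) ->
  partial_grad_lipschitz f S L ->
  block_restr S v = v ->
  f (x + v) <= f x + dotp (grad f x) v + L / 2 * dotp v v.
Proof.
move=> fd lip Sv; apply: descent => // s s0.
rewrite -[X in dotp _ X]Sv -dotp_block_restr block_restrB.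
apply: le_trans (dotp_le _ _) _.
have := lip x (s *: v).
have -> : block_restr S (s *: v) = s *: v.
  by rewrite -{2}Sv; apply/mxcolP => i; rewrite submxcolZ !submxcol_block_restr submxcolZ; case: ifP; rewrite ?scaler0.
rewrite (addrC x) l2normZ ger0_norm// => h.
apply: (le_trans (ler_wpM2r (l2norm_ge0 v) h)).
by rewrite -sqr_l2norm expr2 !mulrA.
Qed.

Section Separable.
Context (g : forall i, 'cV[R]_(p_ i) -> \bar R) (mu : R).
Hypotheses (g_proper : forall i, proper_fun (@g i))
  (g_convex : forall i, convex_efun (@g i))
  (mu_gt0 : 0 < mu) (g_strong : strongly_convex_efun mu (separable_sum (@g))).

Definition block_dom v := forall i, g (submxcol v i) \is a fin_num.

(** [fine] sends infinite values to 0, so this is the value of the separable sum only on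
    [block_dom]. *)
Definition real_sum v : R := \sum_i fine (g (submxcol v i)).

Lemma separable_sumE v : block_dom v -> separable_sum (@g) v = (real_sum v)%:E.
Proof.
by move=> dv; rewrite /separable_sum /real_sum -sumEFin; apply: eq_bigr => i _; rewrite fineK.
Qed.

Lemma convex_fin_num i (u v : 'cV[R]_(p_ i)) (s : R) : 0 <= s <= 1 ->
  g u \is a fin_num -> g v \is a fin_num -> g (s *: u + (1 - s) *: v) \is a fin_num.
Proof.
move=> s01 gu gv; rewrite fin_numElt ltNye (g_proper i).1/=.
by apply: (le_lt_trans (g_convex u v s01)); rewrite -(fineK gu) -(fineK gv) ltry.
Qed.

Lemma block_dom_convex u v (s : R) : 0 <= s <= 1 ->
  block_dom u -> block_dom v -> block_dom (s *: u + (1 - s) *: v).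
Proof.
by move=> s01 du dv i; rewrite submxcolD !submxcolZ; exact: convex_fin_num.
Qed.

Lemma real_sum_strong u v (s : R) : 0 <= s <= 1 ->
  block_dom u -> block_dom v ->
  real_sum (s *: u + (1 - s) *: v) <=
  s * real_sum u + (1 - s) * real_sum v - mu / 2 * (s * (1 - s)) * dotp (u - v) (u - v).
Proof.
move=> s01 du dv; have := g_strong u v s01.
rewrite !separable_sumE//; last exact: block_dom_convex.
by rewrite -!EFinM -!EFinD lee_fin sqr_l2norm.
Qed.

(** Properness provides a competitor of finite value. Hence a block enters the domain as soon as it
    is selected. *)
Lemma argmin_fin_num i (G : 'cV[R]_(p_ i)) (y v : 'cV[R]_(p_ i)) (eta : R) :
  is_argmin (fun u : 'cV[R]_(p_ i) => (dotp G u)%:E + g u + (eta / 2 * l2norm (u - y) ^+ 2)%:E)%E v ->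
  g v \is a fin_num.
Proof.
move=> vmin; have [u gu] := (g_proper i).2.
have gNy := (g_proper i).1.
have := vmin u; rewrite fin_numE gNy/=.
have : g u \is a fin_num by rewrite fin_numE gu gNy.
by move=> /fineK <-; apply: contraTN => /eqP ->; rewrite addeC -EFinD.
Qed.

(** At the midpoint of two minimisers the proximal term would lower the value by [eta / 8] times
    their squared distance. Uniqueness makes the iterates functions of the sampled sets. *)
Lemma argmin_unique i (G : 'cV[R]_(p_ i)) (y u v : 'cV[R]_(p_ i)) (eta : R) :
  0 < eta ->
  let h := (fun u : 'cV[R]_(p_ i) => (dotp G u)%:E + g u + (eta / 2 * l2norm (u - y) ^+ 2)%:E)%E in
  is_argmin h u -> is_argmin h v -> u = v.
Proof.
move=> eta0 h umin vmin.
have gu := argmin_fin_num umin; have gv := argmin_fin_num vmin.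
have huv : h u = h v by apply/eqP; rewrite eq_le umin vmin.
have s01 : 0 <= (2^-1 : R) <= 1 by lra.
have gw := convex_fin_num s01 gu gv.
have := g_convex u v s01.
have := umin (2^-1 *: u + (1 - 2^-1) *: v).
move: huv; rewrite /h -(fineK gu) -(fineK gv) -(fineK gw).
rewrite -!EFinM -!EFinD !lee_fin => -[].
rewrite !sqr_l2norm dotp_convex_comb.
rewrite (dotpDr (2^-1 *: u)) !dotpZr => e1 e2 e3.
have : eta / 8 * dotp (u - v) (u - v) <= 0 by lra.
rewrite pmulr_rle0; last by lra.
move=> d0; apply/eqP; rewrite -subr_eq0 -dotp_eq0 eq_le d0/=; exact: dotp_ge0.
Qed.

(** Three-point inequality of the proximal step. Strong convexity is given for the whole sum of the
    blocks, so the selected blocks are treated jointly. *)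
Lemma block_argmin S (G x xp u : 'cV[R]_N) (eta : R) : 0 <= eta ->
  (forall i, i \in S -> is_argmin (fun v : 'cV[R]_(p_ i) => (dotp (submxcol G i) v)%:E + g v
      + (eta / 2 * l2norm (v - submxcol x i) ^+ 2)%:E)%E (submxcol xp i)) ->
  block_dom u ->
  \sum_(i in S) (dotp (submxcol G i) (submxcol xp i - submxcol u i)
    + fine (g (submxcol xp i)) - fine (g (submxcol u i))
    + eta / 2 * (dotp (submxcol (xp - x) i) (submxcol (xp - x) i)
       - dotp (submxcol (u - x) i) (submxcol (u - x) i)
       + dotp (submxcol (u - xp) i) (submxcol (u - xp) i))
    + mu / 2 * dotp (submxcol (u - xp) i) (submxcol (u - xp) i)) <= 0.
Proof.
move=> eta0 xmin du.
pose hr i (v : 'cV[R]_(p_ i)) := dotp (submxcol G i) v + fine (g v)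
  + eta / 2 * dotp (v - submxcol x i) (v - submxcol x i).
pose D i := dotp (submxcol (u - xp) i) (submxcol (u - xp) i).
suff : \sum_(i in S) hr i (submxcol xp i) + (eta + mu) / 2 * \sum_(i in S) D i
       <= \sum_(i in S) hr i (submxcol u i).
  rewrite -subr_le0 mulr_sumr -big_split -sumrB/= => le0.
  apply: le_trans le0; rewrite le_eqVlt; apply/orP; left; apply/eqP.
  by apply: eq_bigr => i _; rewrite /hr /D !submxcolB !dotpE; ring.
have hrle i (v : 'cV[R]_(p_ i)) : i \in S -> g v \is a fin_num -> hr i (submxcol xp i) <= hr i v.
  move=> iS gv; have := xmin i iS v.
  rewrite -(fineK gv) -(fineK (argmin_fin_num (xmin i iS))) -!EFinD lee_fin.
  by rewrite !sqr_l2norm.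
(* [z] agrees with [xp] on S and with [u] elsewhere. Between [z] and [u] only selected blocks move,
   so all other blocks cancel in the strong convexity inequality. *)
pose z := block_restr S (xp - u) + u.
have zE i : submxcol z i = if i \in S then submxcol xp i else submxcol u i.
  rewrite submxcolD submxcol_block_restr; case: ifP; rewrite ?add0r// => _.
  by rewrite submxcolB subrK.
have dz : block_dom z.
  move=> i; rewrite zE; case: ifP => // iS; exact: argmin_fin_num (xmin i iS).
have S0 : 0 <= \sum_(i in S) D i by apply: sumr_ge0 => i _; exact: dotp_ge0.
apply: quadratic_growth => [|s /andP[s0 s1]].
  by rewrite mulr_ge0// divr_ge0// addr_ge0// ltW.
have s01 : 0 <= s <= 1 by rewrite !ltW.
pose w := s *: u + (1 - s) *: z.
have dw : block_dom w by exact: block_dom_convex.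
have gw := real_sum_strong s01 du dz.
have wS i : i \in S -> submxcol w i = s *: submxcol u i + (1 - s) *: submxcol xp i.
  by move=> iS; rewrite submxcolD !submxcolZ zE iS.
have wNS i : i \notin S -> submxcol w i = submxcol u i.
  by move=> /negPf iS; rewrite submxcolD !submxcolZ zE iS -scalerDl addrC subrK scale1r.
have Dz : dotp (u - z) (u - z) = \sum_(i in S) D i.
  rewrite dotp_submxcol [RHS]big_mkcond/=; apply: eq_bigr => i _.
  by rewrite submxcolB zE /D submxcolB; case: ifP => //; rewrite subrr dotp0l.
have Gw : real_sum w - s * real_sum u - (1 - s) * real_sum z
    = \sum_(i in S) (fine (g (submxcol w i)) - s * fine (g (submxcol u i))
        - (1 - s) * fine (g (submxcol xp i))).
  rewrite /real_sum !mulr_sumr -!sumrB [RHS]big_mkcond/=; apply: eq_bigr => i _.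
  by case: ifPn => iS; rewrite zE ?iS ?(negPf iS)// wNS//; ring.
have le1 : \sum_(i in S) hr i (submxcol xp i) <= \sum_(i in S) hr i (submxcol w i).
  by apply: ler_sum => i iS; exact: hrle.
apply: (le_trans le1).
have -> : \sum_(i in S) hr i (submxcol w i) = s * \sum_(i in S) hr i (submxcol u i)
   + (1 - s) * \sum_(i in S) hr i (submxcol xp i)
   + (real_sum w - s * real_sum u - (1 - s) * real_sum z)
   - eta / 2 * (s * (1 - s)) * \sum_(i in S) D i.
  rewrite Gw !mulr_sumr -!big_split -sumrB/=; apply: eq_bigr => i iS.
  rewrite /hr wS// dotp_convex_comb (dotpDr (s *: _)) !dotpZr /D submxcolB; ring.
by move: gw; rewrite Dz -/w; lra.
Qed.

Context (f : 'cV[R]_N -> R).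
Hypotheses (f_diff : forall z, differentiable (f : _ -> R^o) z)
  (f_convex : @convex_function R 'cV[R]_N setT f).

(* The contribution of block i to the progress of an iteration that selects it:
   it only depends on the current iterate, so its sum over a random block set
   can be averaged. *)
Definition block_gain q (A_ : forall i, 'M[R]_(q, p_ i)) (u x : 'cV[R]_N)
    (y : 'cV[R]_q) (i : 'I_M) : R :=
  dotp (submxcol (grad f x) i) (submxcol (x - u) i)
  + fine (g (submxcol x i)) - fine (g (submxcol u i))
  - dotp y (A_ i *m submxcol (x - u) i)
  + mu / 2 * dotp (submxcol (x - u) i) (submxcol (x - u) i).

Definition real_objective v := f v + real_sum v.

Lemma mulmx_submxcol q (A_ : forall i, 'M[R]_(q, p_ i)) v :
  (\mxrow_i A_ i) *m v = \sum_i A_ i *m submxcol v i.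
Proof. by rewrite -{1}(submxcolK v) mul_mxrow_mxcol. Qed.

(** Deterministic core of one iteration. The difference of the two [block_gain] sums is the term
    whose mean vanishes for a uniform sample when theta = m / M. *)
Lemma block_step q (A_ : forall i, 'M[R]_(q, p_ i)) (S : {set 'I_M})
    (theta beta eta L : R) (x xp u : 'cV[R]_N) (l r : 'cV[R]_q) :
  let A := \mxrow_i A_ i in let y := l - beta *: r in
  0 <= theta -> 0 <= eta ->
  partial_grad_lipschitz f S L ->
  r = A *m x - A *m u -> block_dom u ->
  (forall i, i \in S ->
    is_argmin (@block_objective R M p_ q f (@g) A_ beta eta x l r i) (submxcol xp i)) ->
  (forall i, i \notin S -> submxcol xp i = submxcol x i) ->
  (real_objective xp - real_objective u + mu / 2 * dotp (xp - u) (xp - u))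
  - (1 - theta) * (real_objective x - real_objective u + mu / 2 * dotp (x - u) (x - u))
  + (\sum_(i in S) block_gain A_ u x y i - theta * \sum_i block_gain A_ u x y i)
  - dotp y (A *m xp - A *m u) + (1 - theta) * dotp y r
  + (eta - L) / 2 * dotp (xp - x) (xp - x)
  + eta / 2 * (dotp (xp - u) (xp - u) - dotp (x - u) (x - u)) <= 0.
Proof.
move=> A y theta0 eta0 lip rE du xmin xfix.
pose G := grad f x - A^T *m y.
have GE i : submxcol G i = submxcol (grad f x) i - (A_ i)^T *m y.
  by rewrite submxcolB tr_mxrow mxcol_mul mxcolK.
have {xmin} xmin i : i \in S ->
    is_argmin (fun v : 'cV[R]_(p_ i) => (dotp (submxcol G i) v)%:E + g v
      + (eta / 2 * l2norm (v - submxcol x i) ^+ 2)%:E)%E (submxcol xp i).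
  by move=> iS; rewrite GE; exact: xmin.
have {xmin} opt := block_argmin eta0 xmin du.
(* The part of the optimality inequality beyond the gains. It vanishes off S, where x is unchanged,
   so it can be summed over all blocks. *)
pose rest i := dotp (submxcol (grad f x) i) (submxcol (xp - x) i)
  - dotp y (A_ i *m submxcol (xp - x) i)
  + (fine (g (submxcol xp i)) - fine (g (submxcol x i)))
  + eta / 2 * (dotp (submxcol (xp - x) i) (submxcol (xp - x) i)
      - dotp (submxcol (x - u) i) (submxcol (x - u) i)
      + dotp (submxcol (xp - u) i) (submxcol (xp - u) i))
  + mu / 2 * (dotp (submxcol (xp - u) i) (submxcol (xp - u) i)
      - dotp (submxcol (x - u) i) (submxcol (x - u) i)).
have optE : \sum_(i in S) block_gain A_ u x y i + \sum_i rest i <= 0.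
  apply: le_trans opt.
  have -> : \sum_i rest i = \sum_(i in S) rest i.
    rewrite [RHS]big_mkcond/=; apply: eq_bigr => i _; case: ifPn => // /xfix xi.
    by rewrite /rest !submxcolB xi !subrr dotp0r mulmx0 !dotp0r; ring.
  rewrite -big_split/= le_eqVlt; apply/orP; left; apply/eqP; apply: eq_bigr => i _.
  rewrite GE /block_gain /rest !(submxcolB, mulmxBr, dotpDl, dotpDr, dotpNl, dotpNr).
  by rewrite !dotp_trmx !(dotpC (submxcol u i)) (dotpC (submxcol x i) (submxcol xp i)); ring.
have restE : \sum_i rest i = dotp (grad f x) (xp - x) - dotp y (A *m (xp - x))
  + (real_sum xp - real_sum x)
  + eta / 2 * (dotp (xp - x) (xp - x) - dotp (x - u) (x - u) + dotp (xp - u) (xp - u))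
  + mu / 2 * (dotp (xp - u) (xp - u) - dotp (x - u) (x - u)).
  rewrite mulmx_submxcol dotp_sumr /real_sum !dotp_submxcol.
  by rewrite /rest !(big_split, sumrB, sumrN, =^~ mulr_sumr)/= ; ring.
have gainE : \sum_i block_gain A_ u x y i = dotp (grad f x) (x - u)
  + real_sum x - real_sum u - dotp y (A *m (x - u)) + mu / 2 * dotp (x - u) (x - u).
  rewrite mulmx_submxcol dotp_sumr /real_sum !dotp_submxcol.
  by rewrite /block_gain !(big_split, sumrB, sumrN, =^~ mulr_sumr)/= ; ring.
have Sx : block_restr S (xp - x) = xp - x.
  by apply: block_restr_id => i /xfix xi; rewrite submxcolB xi subrr.
have des := descent_block x f_diff lip Sx.
have cvx := convex_grad f_diff x u f_convex.
(* Multiplied by [theta], this convexity bound produces the factor [1 - theta] in front of the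
   current gap. *)
have gain_ge : real_objective x - real_objective u + mu / 2 * dotp (x - u) (x - u)
    - dotp y r <= \sum_i block_gain A_ u x y i.
  rewrite gainE rE mulmxBr /real_objective.
  by move: cvx; rewrite -opprB dotpNr; lra.
have := ler_wpM2l theta0 gain_ge.
move: optE des; rewrite restE /real_objective (addrC x (xp - x)) subrK rE mulmxBr !dotpDr !dotpNr.
lra.
Qed.

End Separable.
End BlockVectors.

(** * The objective: domain, subgradients and Jensen's inequality *)

Section Objective.
Context {R : realType} (M : nat) (p_ : 'I_M -> nat).
Local Notation N := (\sum_i p_ i)%N.
Context (f : 'cV[R]_N -> R) (g : forall i, 'cV[R]_(p_ i) -> \bar R) (mu : R).
Hypotheses (f_convex : @convex_function R 'cV[R]_N setT f)
  (g_proper : forall i, proper_fun (@g i))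
  (g_convex : forall i, convex_efun (@g i))
  (mu_gt0 : 0 < mu) (g_strong : strongly_convex_efun mu (separable_sum (@g))).
Local Notation dom := (block_dom g).
Local Notation obj := (real_objective g f).

Lemma objectiveE v : dom v -> objective f (@g) v = (obj v)%:E.
Proof. by move=> dv; rewrite /objective separable_sumE. Qed.

Lemma objective_fin_num v : objective f (@g) v \is a fin_num <-> dom v.
Proof.
split=> [|dv]; last by rewrite objectiveE.
by rewrite /objective fin_numD/= => /sum_fin_numP Fv i; apply: Fv; rewrite ?mem_index_enum.
Qed.

Lemma real_objective_strong u v (s : R) : 0 <= s <= 1 -> dom u -> dom v ->
  obj (s *: u + (1 - s) *: v) <=
  s * obj u + (1 - s) * obj v - mu / 2 * (s * (1 - s)) * dotp (u - v) (u - v).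
Proof.
move=> s01 du dv; have := convex_functionE u v f_convex s01.
have := real_sum_strong g_proper g_convex g_strong s01 du dv.
by rewrite /real_objective; lra.
Qed.

Lemma objective_neqNy z : objective f (@g) z != -oo%E.
Proof.
rewrite /objective adde_eq_ninfty negb_or//=.
by rewrite esum_eqNy; apply/existsP => -[i /andP[_]]; rewrite (negPf ((g_proper i).1 _)).
Qed.

(** An infinite value at [xs] would violate the subgradient inequality at a point assembled from
    blocks of finite value. *)
Lemma subdiff_dom xs v : subdiff (objective f (@g)) xs v -> dom xs.
Proof.
move=> sub; apply/objective_fin_num.
rewrite fin_numE objective_neqNy/=.
pose y : 'cV[R]_N := \mxcol_i projT1 (cid (g_proper i).2).
have dy : dom y.
  move=> i; rewrite mxcolK fin_numE (g_proper i).1/=.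
  exact: projT2 (cid (g_proper i).2).
have := sub y; rewrite (objectiveE dy); apply: contraTN => /eqP ->.
by rewrite addye.
Qed.

(** F minus the linear form of [v] is minimal at [xs]; [quadratic_growth] on the segment towards [y]
    recovers the full modulus [mu]. *)
Lemma subdiff_growth xs v y : subdiff (objective f (@g)) xs v -> dom y ->
  obj xs + dotp v (y - xs) + mu / 2 * dotp (y - xs) (y - xs) <= obj y.
Proof.
move=> sub dy; have dxs := subdiff_dom sub.
have : obj xs + mu / 2 * dotp (y - xs) (y - xs) <= obj y - dotp v (y - xs).
  apply: quadratic_growth => [|s /andP[s0 s1]].
    by rewrite mulr_ge0 ?dotp_ge0// divr_ge0// ltW.
  have s01 : 0 <= s <= 1 by rewrite !ltW.
  have := sub (s *: y + (1 - s) *: xs).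
  rewrite !objectiveE//; last exact: block_dom_convex.
  rewrite -EFinD lee_fin => h.
  have := real_objective_strong s01 dy dxs.
  have E : dotp v (s *: y + (1 - s) *: xs - xs) = s * dotp v (y - xs).
    by rewrite !dotpE; ring.
  by move: h; rewrite E; lra.
by lra.
Qed.

(** Induction merges the head of the list into the distinguished point [z0] and adds up the two
    weights. *)
Lemma jensen (I : eqType) (s : seq I) (a : I -> R) (z : I -> 'cV[R]_N) (c0 : R) z0 :
  0 < c0 -> dom z0 -> (forall i, i \in s -> 0 < a i /\ dom (z i)) ->
  let T := c0 + \sum_(i <- s) a i in
  let zbar := T^-1 *: (c0 *: z0 + \sum_(i <- s) a i *: z i) in
  [/\ 0 < T, dom zbar & T * obj zbar <= c0 * obj z0 + \sum_(i <- s) a i * obj (z i)].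
Proof.
elim: s c0 z0 => [|j s IH] c0 z0 c0_gt0 dz0 H T zbar.
  rewrite /zbar /T !big_nil !addr0 scalerA mulVf ?gt_eqF// scale1r.
  by split.
have [aj dzj] : 0 < a j /\ dom (z j) by apply: H; rewrite mem_head.
have ca : 0 < c0 + a j by rewrite addr_gt0.
pose w := c0 / (c0 + a j).
have w01 : 0 <= w <= 1.
  apply/andP; split; first by rewrite divr_ge0 ?ltW.
  by rewrite ler_pdivrMr// mul1r lerDl ltW.
have wE : 1 - w = a j / (c0 + a j).
  by rewrite /w; field; rewrite gt_eqF.
pose z1 := w *: z0 + (1 - w) *: z j.
have dz1 : dom z1 by exact: block_dom_convex.
have [] := IH (c0 + a j) z1 ca dz1.
  by move=> i si; apply: H; rewrite in_cons si orbT.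
have z1E : (c0 + a j) *: z1 = c0 *: z0 + a j *: z j.
  by rewrite /z1 wE /w scalerDr !scalerA !(mulrC _ (_ / _)) !divfK ?gt_eqF.
have TE : c0 + a j + \sum_(i <- s) a i = T by rewrite /T big_cons addrA.
rewrite z1E TE -addrA -(big_cons _ _ j s xpredT (fun i => a i *: z i)) => T0 dzb le.
split => //.
rewrite big_cons; apply: (le_trans le); rewrite addrA lerD2r.
have := real_objective_strong w01 dz0 dzj; rewrite -/z1 => h.
have {}h : obj z1 <= w * obj z0 + (1 - w) * obj (z j).
  apply: (le_trans h); rewrite gerBl mulr_ge0 ?dotp_ge0//.
  by case/andP: w01 => w0 w1; apply: mulr_ge0; [rewrite divr_ge0 ?ltW|rewrite mulr_ge0 ?subr_ge0].
rewrite -(ler_pM2l ca) in h; apply: (le_trans h).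
rewrite mulrDr wE /w !mulrA !(mulrC (c0 + a j)).
by rewrite -!(mulrAC _ (_ + _)^-1) !divfK ?gt_eqF.
Qed.

End Objective.

(** * Averaging over the sampled block sets *)

(** Sets avoiding i are counted by C(M-1, m), and Pascal's rule gives those containing i. The
    identity says that i is selected with probability m / M. *)
Lemma card_draws_mem (M m : nat) (i : 'I_M) : (0 < m)%N ->
  (M * #|[set s : {set 'I_M} | (#|s| == m) && (i \in s)]%SET| = m * 'C(M, m))%N.
Proof.
case: m => // m _.
have M_gt0 : (0 < M)%N by exact: leq_ltn_trans (leq0n i) (ltn_ord i).
have := cardsID ([set s : {set 'I_M} | i \in s]%SET) [set s : {set 'I_M} | #|s| == m.+1]%SET.
have -> : [set s : {set 'I_M} | #|s| == m.+1]%SET :\: [set s : {set 'I_M} | i \in s]%SET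
    = [set s : {set 'I_M} | s \subset [set~ i]%SET & #|s| == m.+1]%SET.
  by apply/setP => s; rewrite !inE finset.subsets_disjoint finset.setCK disjoint_sym disjoints1.
have -> : [set s : {set 'I_M} | #|s| == m.+1]%SET :&: [set s : {set 'I_M} | i \in s]%SET
    = [set s : {set 'I_M} | (#|s| == m.+1) && (i \in s)]%SET by apply/setP => s; rewrite !inE.
rewrite cards_draws card_draws cardsC1 card_ord => cE.
have -> : #|[set s : {set 'I_M} | (#|s| == m.+1) && (i \in s)]%SET| = 'C(M.-1, m).
  by apply/eqP; rewrite -(eqn_add2r 'C(M.-1, m.+1)) cE addnC -binS prednK.
exact: mul_bin_diag.
Qed.

Section Sampling.
Context {R : realType} d (Omega : measurableType d) (P : probability Omega R).
Context (M m t : nat) (S : nat -> Omega -> {set 'I_M}).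
Hypotheses (m_bounds : (1 <= m <= M)%N) (S_unif : uniform_sampling P m t S).

Definition same_sets n (w w' : Omega) :=
  forall j, (1 <= j <= n)%N -> S j w = S j w'.

Definition past n (h : nat -> {set 'I_M}) :=
  [set w | forall j, (1 <= j < n.+1)%N -> S j w = h j].

Lemma past0 h : past 0 h = setT.
Proof. by apply/seteqP; split => // w _ [|j]. Qed.

Lemma pastS n h : past n.+1 h = [set w | S n.+1 w = h n.+1] `&` past n h.
Proof.
apply/seteqP; split => [w H|w [H1 H2] j /andP[j1]].
  split; first by apply: H; rewrite /= ltnSn.
  by move=> j /andP[j1 jn]; apply: H; rewrite j1 (leq_trans jn).
by rewrite ltnS leq_eqVlt => /orP[/eqP->//|jn]; apply: H2; rewrite j1.
Qed.

Lemma measurable_past n h : (n <= t)%N -> measurable (past n h).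
Proof.
elim: n => [_|n IH nt]; first by rewrite past0.
rewrite pastS; apply: measurableI; last exact/IH/ltnW.
by have [|_ + _ _] := S_unif (k := n.+1); [rewrite nt|apply].
Qed.

(** Independence contributes one factor per draw, so all histories of m-element sets are equally
    likely. *)
Lemma prob_past n (h : nat -> {set 'I_M}) : (n <= t)%N ->
  (forall j, (1 <= j <= n)%N -> #|h j| = m) ->
  P (past n h) = ('C(M, m)%:R^-1 ^+ n)%:E.
Proof.
elim: n => [_ _|n IH nt hm]; first by rewrite past0 probability_setT.
have [|_ _ Pm Pind] := S_unif (k := n.+1); first by rewrite nt.
rewrite pastS [X in P X](_ : _ = [set w | S n.+1 w = h n.+1 /\
  forall j, (1 <= j < n.+1)%N -> S j w = h j])//.
rewrite Pind Pm; last by apply: hm; rewrite /= leqnn.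
rewrite -/(past n h) IH; first by rewrite -EFinM exprS.
- exact: ltnW.
- by move=> j /andP[j1 jn]; apply: hm; rewrite j1 ltnW.
Qed.

Let hist_type := {ffun 'I_t -> {set 'I_M}}.
Let hist (w : Omega) : hist_type := [ffun j : 'I_t => S j.+1 w].
Let Hm := [set h : hist_type | [forall j, #|h j| == m]]%SET.
(** Entry j of a finite history is the draw of iteration j + 1; indices above t get the empty
    set. *)
Let ext (h : hist_type) (j : nat) : {set 'I_M} :=
  if insub j.-1 is Some j' then h j' else finset.set0.

Let extE (h : hist_type) (j : 'I_t) : ext h j.+1 = h j.
Proof. by rewrite /ext /= valK. Qed.

Let hist_fiber h : [set w | hist w = h] = past t (ext h).
Proof.
apply/seteqP; split => [w <- [//|j] /= jt|w H].
  by rewrite -[j]/(val (Ordinal (jt : (j < t)%N))) extE ffunE.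
by apply/ffunP => j; rewrite ffunE H ?extE//= ltnS.
Qed.

Let measurable_fiber h : measurable [set w | hist w = h].
Proof. by rewrite hist_fiber; exact: measurable_past. Qed.

Let prob_fiber h : h \in Hm -> P [set w | hist w = h] = ('C(M, m)%:R^-1 ^+ t)%:E.
Proof.
rewrite inE => /forallP hm; rewrite hist_fiber prob_past// => -[//|j] /= jt.
by rewrite -[j]/(val (Ordinal (jt : (j < t)%N))) extE; exact/eqP.
Qed.

Let bin_gt0R : 0 < 'C(M, m)%:R :> R.
Proof. by rewrite ltr0n bin_gt0; case/andP: m_bounds. Qed.

Let hist_Hm w : hist w \in Hm.
Proof.
rewrite inE; apply/forallP => j; rewrite ffunE; apply/eqP.
by have [|+ _ _ _] := S_unif (k := j.+1); [rewrite /= ltn_ord|apply].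
Qed.

(** A history of positive probability is realised by some sample point. *)
Let hist_surj h : h \in Hm -> exists w, hist w = h.
Proof.
move=> hm; apply: contrapT => nex; have := prob_fiber hm.
rewrite [X in P X](_ : _ = set0); last first.
  by apply/seteqP; split => // w hw; apply: nex; exists w.
rewrite measure0 => -[] /esym/eqP.
by rewrite expf_eq0 invr_eq0 gt_eqF// andbF.
Qed.

Let same_hist w w' : hist w = hist w' -> same_sets t w w'.
Proof.
move=> hw [//|j] /= jt.
by have := congr1 (fun h : hist_type => h (Ordinal jt)) hw; rewrite !ffunE.
Qed.

Let upd (h : hist_type) (k : 'I_t) (s : {set 'I_M}) : hist_type :=
  [ffun j => if j == k then s else h j].

(** Independence of one draw in counting form: [zeta] ignores entry k, which may be exchanged with a
    fresh draw, and [card_draws_mem] counts the draws containing i. *)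
Let sum_hist (zeta : hist_type -> R) (k : 'I_t) (i : 'I_M) :
  (forall h s, h \in Hm -> upd h k s \in Hm -> zeta (upd h k s) = zeta h) ->
  \sum_(h in Hm) (i \in h k)%:R * zeta h = m%:R / M%:R * \sum_(h in Hm) zeta h.
Proof.
move=> zk.
pose Sm := [set s : {set 'I_M} | #|s| == m]%SET.
have M0 : M%:R != 0 :> R.
  by rewrite pnatr_eq0 -lt0n; case/andP: m_bounds; exact: leq_trans.
apply: (mulfI (lt0r_neq0 bin_gt0R)).
transitivity (\sum_(h in Hm) \sum_(s in Sm) (i \in s)%:R * zeta h); last first.
  have cE : M%:R * #|[set s : {set 'I_M} | (#|s| == m) && (i \in s)]%SET|%:R
            = m%:R * 'C(M, m)%:R :> R.
    by rewrite -!natrM card_draws_mem//; case/andP: m_bounds.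
  have -> : 'C(M, m)%:R * (m%:R / M%:R * \sum_(h in Hm) zeta h)
     = #|[set s : {set 'I_M} | (#|s| == m) && (i \in s)]%SET|%:R * \sum_(h in Hm) zeta h.
    rewrite mulrA; congr (_ * _); apply: (mulfI M0); rewrite cE.
    by field.
  rewrite mulr_sumr; apply: eq_bigr => h _; rewrite -mulr_suml; congr (_ * _).
  rewrite -sum1_card natr_sum big_mkcond [RHS]big_mkcond/=; apply: eq_bigr => s _.
  by rewrite !inE; case: (#|s| == m); case: (i \in s).
(* Exchanging entry k with the fresh draw is an involution on the admissible pairs. *)
pose sw (u : hist_type * {set 'I_M}) := (upd u.1 k u.2, u.1 k).
have swK : involutive sw.
  move=> [h s]; rewrite /sw /= ffunE eqxx; congr (_, _).
  by apply/ffunP => j; rewrite !ffunE; case: eqP => // ->.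
rewrite pair_big/= (reindex_inj (inv_inj swK))/=.
transitivity (\sum_(h in Hm) \sum_(s in Sm) (i \in h k)%:R * zeta h).
  rewrite mulr_sumr; apply: eq_bigr => h _.
  by rewrite [LHS]mulr_natl sumr_const card_draws card_ord.
have swH h s : ((upd h k s \in Hm) && (h k \in Sm)) = ((h \in Hm) && (s \in Sm)).
  rewrite !inE; apply/andP/andP => -[/forallP hm hs].
    split; last by have := hm k; rewrite ffunE eqxx.
    by apply/forallP => j; have := hm j; rewrite ffunE; case: (j =P k) => // -> _.
  split; last exact: hm.
  by apply/forallP => j; rewrite ffunE; case: ifP.
rewrite pair_big/=; apply: eq_big => [[h s]|[h s]] /=; first by rewrite swH.
move=> hs; have := swH h s; rewrite hs => /andP[uhm _].
by case/andP: hs => hm _; rewrite zk.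
Qed.

(* All random quantities of the method are functions of S_1, ..., S_t, so the
   expectation is a uniform average over one sample point per history. *)
Lemma sampling_average : exists (W : seq Omega) (c : R), [/\ 0 <= c,
  forall G : Omega -> R, (forall w w', same_sets t w w' -> G w = G w') ->
    (\int[P]_w (G w)%:E = (c * \sum_(w <- W) G w)%:E)%E &
  forall k i (Z : Omega -> R), (1 <= k <= t)%N ->
    (forall w w', same_sets k.-1 w w' -> Z w = Z w') ->
    \sum_(w <- W) (i \in S k w)%:R * Z w = m%:R / M%:R * \sum_(w <- W) Z w].
Proof.
have [w0 _] : exists w : Omega, True.
  apply: contrapT => nex; have := probability_setT P.
  rewrite [X in P X](_ : _ = set0); last first.
    by apply/seteqP; split => // w _; apply: nex; exists w.
  by rewrite measure0 => /eqP; rewrite eqe eq_sym oner_eq0.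
pose rep h := if pselect (exists w, hist w = h) is left e then projT1 (cid e) else w0.
have repK h : h \in Hm -> hist (rep h) = h.
  move=> /hist_surj e; rewrite /rep; case: pselect => // e'.
  exact: projT2 (cid e').
exists [seq rep h | h <- enum Hm], ('C(M, m)%:R^-1 ^+ t); split.
- by rewrite exprn_ge0// invr_ge0 ltW.
- move=> G Gadapt.
  have GE w : G w = G (rep (hist w)) by apply/Gadapt/same_hist; rewrite repK.
  have cover : [set: Omega] = \big[setU/set0]_(h <- enum Hm) [set w | hist w = h].
    rewrite -bigcup_seq; apply/seteqP; split => // w _.
    by exists (hist w) => //=; rewrite mem_enum.
  rewrite cover integral_bigsetU_EFin//; first last.
  (* [G] is constant on the finitely many measurable fibres of [hist], so its preimages are finite
     unions of fibres. *)
  + rewrite -cover => _ Y mY; rewrite setTI.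
    have -> : (EFin \o G) @^-1` Y = \big[setU/set0]_(h <- enum Hm |
        `[< Y (G (rep h))%:E >]) [set w | hist w = h].
      rewrite -bigcup_seq_cond; apply/seteqP; split => [w /= Yw|w [h /= /andP[_ /asboolP Yh] hw]].
        exists (hist w) => //=; rewrite mem_enum hist_Hm/=.
        by apply/asboolP; rewrite -GE.
      by rewrite /= GE hw.
    exact: bigsetU_measurable.
  + by move=> h h' _ _ [w [/= <- <-]].
  + exact: enum_uniq.
  rewrite big_map mulr_sumr -sumEFin !big_enum/=; apply: eq_bigr => h hm.
  rewrite (eq_integral (cst (G (rep h))%:E)); last first.
    by move=> w; rewrite inE/= => hw; rewrite GE hw.
  by rewrite integral_cst// [X in (_ * X)%E](prob_fiber hm) -EFinM mulrC.
- move=> [//|k] i Z /= kt Zpast; rewrite !big_map !big_enum/=.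
  rewrite -(sum_hist (k := Ordinal kt) i) => [|h s].
    apply: eq_bigr => h hm; congr (_%:R * _).
    by rewrite -[in RHS](repK h hm) ffunE.
  move=> hm uhm; apply: Zpast => -[//|j] /= jk.
  have jt : (j < t)%N by rewrite (ltn_trans jk).
  have := congr1 (fun h : hist_type => h (Ordinal jt)) (repK _ uhm).
  have := congr1 (fun h : hist_type => h (Ordinal jt)) (repK _ hm).
  rewrite !ffunE/= => -> ->; case: (Ordinal jt =P _) => // /(congr1 val)/= jE.
  by have := ltnn k; rewrite -[X in (X < _)%N]jE jk.
Qed.

End Sampling.

(** * Step sizes and potential *)

Section StepSizes.
Context {R : realType} (theta k0 mu L rho n2 : R) (beta eta rho_ : nat -> R) (t : nat).
Hypotheses (theta_gt0 : 0 < theta) (theta_le1 : theta <= 1) (mu_gt0 : 0 < mu)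
  (L_ge0 : 0 <= L) (rho_ge1 : 1 <= rho) (n2_gt0 : 0 < n2) (t_ge2 : (2 <= t)%N)
  (k0_def : k0 = 4 / theta + 2 * L / (theta * mu))
  (beta_def : forall k, (1 <= k)%N ->
    beta k = mu * (theta * k%:R + 2 + theta) / (2 * rho * n2))
  (eta_def : forall k, (1 <= k)%N -> eta k = rho * beta k * n2 + L)
  (rho_def : forall k, (1 <= k <= t.-1)%N ->
    rho_ k = theta * beta k / (6 - 5 * theta))
  (rho_t_def :
    rho_ t = (t%:R + k0 + 1) * rho_ t.-1 / (theta * (t%:R + k0 + 1) - 1)).

Definition cweight (k : nat) : R := k%:R + k0 + 1.
(** Equal to [cweight k.-1 - (1 - theta) * cweight k] for k >= 1: what remains of the gap at x^k
    when the inequalities of iterations k - 1 and k are telescoped. *)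
Definition xweight (k : nat) : R := theta * cweight k - 1.
(** The numerator is the coefficient of [dotp (lam k.+1) (r k.+1)] left over after iteration k; at k
    = t no later iteration absorbs a part of it. *)
Definition dweight (k : nat) : R :=
  (if (k < t)%N then xweight k.+1 else cweight t) / (2 * rho_ k).

Ltac lras := move: theta_gt0 theta_le1 mu_gt0 L_ge0 rho_ge1 n2_gt0; lra.
Ltac nras := move: theta_gt0 theta_le1 mu_gt0; nra.

Let B (k : nat) : R := theta * k%:R + 2 + theta.
Let kap : R := mu / (2 * rho * n2).

Let kap_gt0 : 0 < kap.
Proof. by rewrite divr_gt0// !mulr_gt0//; apply: lt_le_trans rho_ge1. Qed.

Let B_ge2 k : 2 <= B k.
Proof. by have := mulr_ge0 (ltW theta_gt0) (ler0n R k); rewrite /B; lras. Qed.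

Let betaE k : (1 <= k)%N -> beta k = kap * B k.
Proof. by move=> k1; rewrite beta_def// /kap /B mulrAC. Qed.

Let BS k : B k.+1 = B k + theta.
Proof. by rewrite /B -[k.+1%:R]natr1; ring. Qed.

Let thetak0E : theta * k0 = 4 + 2 * L / mu.
Proof. by rewrite k0_def; field; rewrite !gt_eqF. Qed.

Let thetak0_ge4 : 4 <= theta * k0.
Proof. by rewrite thetak0E lerDl divr_ge0 ?mulr_ge0// ltW. Qed.

Lemma cweightS k : cweight k.+1 = cweight k + 1.
Proof. by rewrite /cweight -[k.+1%:R]natr1; ring. Qed.

Lemma xweightE k : xweight k = theta * k%:R + theta * k0 + theta - 1.
Proof. by rewrite /xweight /cweight; ring. Qed.

Let theta_cE k : theta * cweight k = B k + theta * k0 - 2.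
Proof. by rewrite /cweight /B; ring. Qed.

Lemma cweight_gt0 k : 0 < cweight k.
Proof.
by rewrite -(pmulr_rgt0 _ theta_gt0) theta_cE; have := B_ge2 k; have := thetak0_ge4; lras.
Qed.

Lemma xweight_gt0 k : 0 < xweight k.
Proof. by rewrite /xweight theta_cE; have := B_ge2 k; have := thetak0_ge4; lras. Qed.

Lemma beta_gt0 k : (1 <= k)%N -> 0 < beta k.
Proof. by move=> k1; rewrite betaE// mulr_gt0//; have := B_ge2 k; lras. Qed.

Lemma etaE k : (1 <= k)%N -> eta k = mu / 2 * B k + L.
Proof.
move=> k1; rewrite eta_def// betaE// /kap; congr (_ + _); field.
by rewrite !gt_eqF//; lras.
Qed.

Lemma eta_gt0 k : (1 <= k)%N -> 0 < eta k.
Proof.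
move=> k1; rewrite etaE// ltr_pwDl// mulr_gt0//; first by rewrite divr_gt0.
by have := B_ge2 k; lras.
Qed.

Lemma eta_ge k : (1 <= k)%N -> beta k * n2 <= eta k - L.
Proof.
move=> k1; rewrite eta_def// addrK -mulrA ler_peMl//.
by rewrite mulr_ge0// ltW// beta_gt0.
Qed.

Let den_gt0 : 0 < 6 - 5 * theta. Proof. by lras. Qed.

Let rho_den k : (1 <= k <= t.-1)%N -> rho_ k * (6 - 5 * theta) = theta * (kap * B k).
Proof.
by move=> kt; rewrite rho_def// divfK ?gt_eqF// betaE//; case/andP: kt.
Qed.

Lemma rho_gt0 k : (1 <= k <= t)%N -> 0 < rho_ k.
Proof.
have lt j : (1 <= j <= t.-1)%N -> 0 < rho_ j.
  move=> jt; rewrite rho_def// divr_gt0// mulr_gt0// beta_gt0//.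
  by case/andP: jt.
move=> /andP[k1]; rewrite leq_eqVlt => /orP[/eqP ->|kt].
  rewrite rho_t_def divr_gt0// ?xweight_gt0// mulr_gt0 ?cweight_gt0//.
  by apply: lt; rewrite leqnn andbT -ltnS prednK// (ltn_trans _ t_ge2).
by apply: lt; rewrite k1 -ltnS prednK// (ltn_trans _ t_ge2).
Qed.

(** Twice the leftover coefficient of |x^(k+1) - u|^2. The terms in k cancel, and the value of [k0]
    cancels L and the constants up to [mu * theta / 2]. *)
Lemma dist_coef_ge0 k : (1 <= k)%N ->
  0 <= mu * xweight k.+1 + cweight k * eta k - cweight k.+1 * eta k.+1.
Proof.
move=> k1; rewrite !etaE// BS cweightS.
have muL : mu * (2 * L / mu) = 2 * L by field; rewrite gt_eqF.
have h : mu * (theta * k0) = 4 * mu + 2 * L by rewrite thetak0E mulrDr muL; lras.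
rewrite xweightE -[k.+1%:R]natr1 /cweight /B.
suff : 0 <= mu * theta by move: h; nras.
by rewrite ltW// mulr_gt0.
Qed.

Lemma res_coef_ge0 k : (1 <= k < t)%N ->
  0 <= cweight k * (beta k / 2 - rho_ k) - cweight k.+1 * ((1 / 2 - theta) * beta k.+1)
       + xweight k.+1 * rho_ k / 2.
Proof.
move=> /andP[k1 kt].
have kt1 : (1 <= k <= t.-1)%N by rewrite k1 -ltnS prednK// (ltn_trans _ t_ge2).
have D := rho_den kt1.
rewrite !betaE// BS; have b2 := B_ge2 k; set b := B k in b2 D *.
have -> : cweight k = cweight k.+1 - 1 by rewrite cweightS addrK.
have y4 : 4 <= theta * cweight k.+1 by rewrite theta_cE BS -/b; have := thetak0_ge4; lras.
rewrite /xweight; set c := cweight k.+1 in y4 *; set r := rho_ k in D *.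
(* Clearing [6 - 5 * theta] lets [D] eliminate [rho_ k]. What remains is a polynomial inequality in
   theta, [y = theta * c >= 4] and [b >= 2]. *)
rewrite -(pmulr_rge0 _ (_ : 0 < 2 * (6 - 5 * theta))); last by lras.
have -> : 2 * (6 - 5 * theta) * ((c - 1) * (kap * b / 2 - r)
    - c * ((1 / 2 - theta) * (kap * (b + theta))) + (theta * c - 1) * r / 2)
  = kap * (theta * c * b * (10 - 9 * theta) - 6 * b * (1 - theta)
      - theta * c * ((6 - 5 * theta) * (1 - 2 * theta)))
    + (theta * c - 1 - 2 * (c - 1)) * (r * (6 - 5 * theta) - theta * (kap * b)).
  by field.
rewrite D subrr mulr0 addr0 mulr_ge0 ?ltW//.
set y := theta * c in y4 *.
have h1 : 0 <= (y - 4) * b by rewrite mulr_ge0; lras.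
have h2 : 0 <= y * (b - 2) by rewrite mulr_ge0; lras.
have h3 : 0 <= (y - 4) * b * (10 - 9 * theta) by rewrite mulr_ge0//; lras.
have h4 : 0 <= y * (b - 2) * (10 - 9 * theta) by rewrite mulr_ge0//; lras.
have h5 : 0 <= y * (4 + 8 * theta - 10 * theta ^+ 2).
  by rewrite mulr_ge0//; [lras|nras].
have h6 : 0 <= b * (14 - 12 * theta) by rewrite mulr_ge0//; lras.
by move: h3 h4 h5 h6; nras.
Qed.

(** At the last iteration no further potential is to be paid: [beta t / 2 - rho_ t] from the primal
    bound and [rho_ t / 2] from the dual one add up to half of this. *)
Lemma last_res_coef_ge0 : 0 <= beta t - rho_ t.
Proof.
have t1 : (1 <= t.-1 <= t.-1)%N by rewrite leqnn andbT -ltnS prednK// (ltn_trans _ t_ge2).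
have tE : t = t.-1.+1 by rewrite prednK// (ltn_trans _ t_ge2).
have D := rho_den t1.
have w0 := xweight_gt0 t.
have W : rho_ t * xweight t = cweight t * rho_ t.-1.
  by rewrite rho_t_def divfK// gt_eqF.
have wb : B t.-1 <= xweight t by rewrite /xweight theta_cE tE BS; have := thetak0_ge4; have := B_ge2 t.-1; lras.
have b2 := B_ge2 t.-1.
rewrite -(pmulr_rge0 _ (mulr_gt0 w0 den_gt0)) betaE; last by rewrite tE.
have -> : B t = B t.-1 + theta by rewrite tE BS.
have -> : xweight t * (6 - 5 * theta) * (kap * (B t.-1 + theta) - rho_ t)
  = kap * (xweight t * (6 - 5 * theta) * (B t.-1 + theta)
           - (xweight t + 1) * B t.-1)
    - (rho_ t * xweight t - cweight t * rho_ t.-1) * (6 - 5 * theta)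
    - cweight t * (rho_ t.-1 * (6 - 5 * theta) - theta * (kap * B t.-1)).
  by rewrite /xweight; ring.
rewrite W D !subrr mul0r mulr0 !subr0.
apply: mulr_ge0; first exact: ltW.
move: wb b2 w0; set b := B t.-1; set w := xweight t => wb b2 w0.
have h1 : 0 <= (w - 2) * b * (1 - theta) by rewrite !mulr_ge0//; lras.
have h2 : 0 <= theta * (1 - theta) * w by rewrite !mulr_ge0//; lras.
have h3 : 0 <= (w - b) * theta by rewrite mulr_ge0//; lras.
have h4 : 0 <= b * (1 - theta) by rewrite mulr_ge0//; lras.
have -> : w * (6 - 5 * theta) * (b + theta) - (w + 1) * b
  = 5 * ((w - 2) * b * (1 - theta)) + 5 * (theta * (1 - theta) * w)
    + (w - b) * theta + 9 * (b * (1 - theta)) by ring.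
by rewrite !addr_ge0// mulr_ge0.
Qed.

Lemma dweight_ge0 k : (1 <= k <= t)%N -> 0 <= dweight k.
Proof.
move=> kt; rewrite /dweight divr_ge0 ?mulr_ge0 ?ltW ?rho_gt0//.
by case: ifP => _; rewrite ?xweight_gt0 ?cweight_gt0.
Qed.

(** Before the last step [xweight] and [B] both grow by theta, and the quotient decreases because
    [B k <= xweight k.+1]. At k + 1 = t equality holds, by the choice of [rho_ t]. *)
Lemma dweight_decr k : (1 <= k < t)%N -> dweight k.+1 <= dweight k.
Proof.
move=> /andP[k1 kt]; rewrite /dweight kt; case: ltnP => [kt2|tk].
  have H1 : (1 <= k <= t.-1)%N by rewrite k1 -ltnS prednK// (ltn_trans _ t_ge2).
  have H2 : (1 <= k.+1 <= t.-1)%N by apply/andP; split => //; rewrite -ltnS prednK// (ltn_trans _ t_ge2).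
  rewrite !rho_def// !betaE// BS.
  have b2 := B_ge2 k; set b := B k in b2 *.
  have xE : xweight k.+2 = xweight k.+1 + theta by rewrite /xweight (cweightS k.+1); ring.
  have wb : b <= xweight k.+1 by rewrite /xweight theta_cE BS -/b; have := thetak0_ge4; lras.
  rewrite xE; set w := xweight k.+1 in wb *.
  have b0 : 0 < b by exact: lt_le_trans b2.
  have bt0 : 0 < b + theta by exact: addr_gt0.
  rewrite ler_pdivrMr; last by rewrite mulr_gt0// divr_gt0// mulr_gt0// mulr_gt0.
  rewrite mulrAC ler_pdivlMr; last by rewrite mulr_gt0// divr_gt0// mulr_gt0// mulr_gt0.
  rewrite -subr_ge0.
  have -> : w * (2 * (theta * (kap * (b + theta)) / (6 - 5 * theta)))
    - (w + theta) * (2 * (theta * (kap * b) / (6 - 5 * theta)))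
    = 2 * theta ^+ 2 * kap * (w - b) / (6 - 5 * theta).
    by field; rewrite gt_eqF.
  apply: divr_ge0; last exact: ltW.
  apply: mulr_ge0; last by rewrite subr_ge0.
  apply: mulr_ge0; last exact: ltW.
  by apply: mulr_ge0 => //; exact: sqr_ge0.
have tE : t = k.+1 by apply/eqP; rewrite eqn_leq tk.
rewrite -tE rho_t_def tE/= -/(cweight k.+1) -/(xweight k.+1).
rewrite le_eqVlt; apply/orP; left; apply/eqP; field.
have rk : 0 < rho_ k by rewrite rho_gt0// k1 ltnW.
by rewrite !gt_eqF ?cweight_gt0 ?xweight_gt0.
Qed.

(** * Decrease of the potential along one trajectory *)

Section Trajectory.
Context (M q : nat) (p_ : 'I_M -> nat).
Local Notation N := (\sum_i p_ i)%N.
Context (f : 'cV[R]_N -> R) (g : forall i : 'I_M, 'cV[R]_(p_ i) -> \bar R)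
  (A_ : forall i : 'I_M, 'M[R]_(q, p_ i)) (b : 'cV[R]_q) (x1 u : 'cV[R]_N)
  (S : nat -> {set 'I_M}) (x : nat -> 'cV[R]_N) (lam r : nat -> 'cV[R]_q).
Local Notation A := (\mxrow_i A_ i).
Hypotheses (f_convex : @convex_function R 'cV[R]_N setT f)
  (f_diff : forall z, differentiable (f : _ -> R^o) z)
  (g_proper : forall i, proper_fun (@g i))
  (g_convex : forall i, convex_efun (@g i))
  (g_strong : strongly_convex_efun mu (separable_sum (@g)))
  (f_lip : forall k, (1 <= k <= t)%N -> partial_grad_lipschitz f (S k) L)
  (A_le : forall v : 'cV[R]_N, dotp (A *m v) (A *m v) <= n2 * dotp v v)
  (u_feasible : A *m u = b) (u_dom : block_dom g u)
  (iterates : primal_dual_bcu f (@g) A_ b beta rho_ eta x1 t S x lam r).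

Lemma residualE k : (1 <= k <= t.+1)%N -> r k = A *m x k - b.
Proof.
case: iterates => x1E _ r1 it; case: k => // k; elim: k => [|k IH] kt.
  by rewrite r1 x1E.
have kt' : (1 <= k.+1 <= t)%N by rewrite /= -ltnS.
have [_ xfix -> _] := it _ kt'.
rewrite IH; last exact: ltnW.
have -> : \sum_(i in S k.+1) A_ i *m (submxcol (x k.+2) i - submxcol (x k.+1) i)
    = A *m (x k.+2 - x k.+1).
  rewrite mulmx_submxcol big_mkcond/=; apply: eq_bigr => i _.
  by rewrite submxcolB; case: ifPn => // /xfix ->; rewrite subrr mulmx0.
by rewrite mulmxBr addrC addrA subrK.
Qed.

(** The second alternative handles a start outside the domain: when all blocks are selected, each
    becomes a minimiser. *)
Lemma iterate_dom_step k : (1 <= k <= t)%N ->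
  block_dom g (x k) \/ S k = [set: 'I_M]%SET -> block_dom g (x k.+1).
Proof.
case: iterates => _ _ _ it kt dS i; have [xmin xfix _ _] := it _ kt.
have [iS|iS] := boolP (i \in S k); first by
  exact: (@argmin_fin_num _ _ _ g g_proper i
    (submxcol (grad f (x k)) i - (A_ i)^T *m (lam k - beta k *: r k))
    (submxcol (x k) i) _ (eta k) (xmin i iS)).
by case: dS => [d|ST]; [rewrite xfix|move: iS; rewrite ST inE].
Qed.

Let E k := real_objective g f (x k) - real_objective g f u.
Let D k := dotp (x k - u) (x k - u).

(* Deviation of the contribution of the selected blocks from its conditional mean. *)
Definition deviation k : R :=
  \sum_(i in S k) block_gain g mu f A_ u (x k) (lam k - beta k *: r k) i
  - theta * \sum_i block_gain g mu f A_ u (x k) (lam k - beta k *: r k) i.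

(** The cross term [beta k * dotp (r k) (r k.+1)] is polarised; its negative square of r^(k+1) - r^k
    is absorbed by the proximal term through [A_le] and [eta_ge]. *)
Lemma step_bound k : (1 <= k <= t)%N ->
  E k.+1 + mu / 2 * D k.+1 - dotp (lam k.+1) (r k.+1)
  + (beta k / 2 - rho_ k) * dotp (r k.+1) (r k.+1) + deviation k + eta k / 2 * D k.+1
  <= (1 - theta) * (E k + mu / 2 * D k - dotp (lam k) (r k))
     + (1 / 2 - theta) * beta k * dotp (r k) (r k) + eta k / 2 * D k.
Proof.
move=> kt; have [_ _ _ it] := iterates; have [xmin xfix _ lamE] := it _ kt.
have /andP[k1 kt'] := kt.
have rE : r k = A *m x k - A *m u by rewrite u_feasible residualE// k1 ltnW.
have rE' : r k.+1 = A *m x k.+1 - A *m u by rewrite u_feasible residualE.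
have := block_step g_proper g_convex mu_gt0 g_strong f_diff f_convex
  (ltW theta_gt0) (ltW (eta_gt0 k1)) (f_lip kt) rE u_dom xmin xfix.
rewrite -rE' -/(deviation k) lamE.
have h1 : dotp (r k.+1 - r k) (r k.+1 - r k) <= n2 * dotp (x k.+1 - x k) (x k.+1 - x k).
  have -> : r k.+1 - r k = A *m (x k.+1 - x k).
    by rewrite rE rE' mulmxBr opprB addrA subrK.
  exact: A_le.
have h2 := ler_wpM2l (ltW (beta_gt0 k1)) h1.
have h3 := ler_wpM2r (dotp_ge0 (x k.+1 - x k)) (eta_ge k1).
have {h2 h3} : beta k * dotp (r k.+1 - r k) (r k.+1 - r k)
    <= (eta k - L) * dotp (x k.+1 - x k) (x k.+1 - x k).
  by apply: (le_trans h2); rewrite mulrA.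
rewrite /E /D !(dotpDl (lam k), dotpDr (r k.+1), dotpDl (r k.+1), dotpNl, dotpNr, dotpZl, dotpZr).
by rewrite (dotpC (r k) (r k.+1)); lra.
Qed.

Definition potential (l : 'cV[R]_q) k : R :=
  cweight k * (1 - theta) * (E k + mu / 2 * D k - dotp (lam k) (r k))
  + cweight k * ((1 / 2 - theta) * beta k) * dotp (r k) (r k)
  + cweight k * eta k / 2 * D k + dweight k * dotp (lam k - l) (lam k - l).

(** Polarisation of the dual update: the pairing of the residual with the new multiplier is traded
    for one with [l], at the cost of telescoping distances. *)
Let dualE l (W : R) k : (1 <= k <= t)%N ->
  - W * dotp (lam k.+1) (r k.+1) =
  - W * dotp l (r k.+1) + W / (2 * rho_ k) *
     (dotp (lam k.+1 - l) (lam k.+1 - l) - dotp (lam k - l) (lam k - l))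
  + W * rho_ k / 2 * dotp (r k.+1) (r k.+1).
Proof.
move=> kt; have [_ _ _ it] := iterates; have [_ _ _ lamE] := it _ kt.
have rk := rho_gt0 kt.
rewrite lamE !dotpE !(dotpC l) !(dotpC (r k.+1) (lam k)); field.
by rewrite gt_eqF.
Qed.

Lemma potential_decr l k : (1 <= k < t)%N ->
  xweight k.+1 * (E k.+1 - dotp l (r k.+1)) + cweight k * deviation k
  + potential l k.+1 <= potential l k.
Proof.
move=> /andP[k1 kt]; have kt' : (1 <= k <= t)%N by rewrite k1 ltnW.
have := ler_wpM2l (ltW (cweight_gt0 k)) (step_bound kt').
have kt2 : (1 <= k < t)%N by rewrite k1.
have h1 := mulr_ge0 (dist_coef_ge0 k1) (dotp_ge0 (x k.+1 - u)).
have h2 := mulr_ge0 (res_coef_ge0 kt2) (dotp_ge0 (r k.+1)).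
have h3 := ler_wpM2r (dotp_ge0 (lam k.+1 - l)) (dweight_decr kt2).
have := dualE l (xweight k.+1) kt'.
rewrite -[_ / (2 * rho_ k)](_ : dweight k = _); last by rewrite /dweight kt.
rewrite /potential; move: h1 h2 h3.
have -> : xweight k.+1 = theta * cweight k.+1 - 1 by [].
rewrite cweightS -/(D k.+1); set c := cweight k.
set dl := dweight k; set dl' := dweight k.+1.
set R' := dotp (r k.+1) (r k.+1); set R0 := dotp (r k) (r k).
set P' := dotp (lam k.+1) (r k.+1); set P0 := dotp (lam k) (r k).
set l' := dotp (lam k.+1 - l) _; set l0 := dotp (lam k - l) _; set Pl := dotp l _.
set b0 := beta k; set b' := beta k.+1; set e0 := eta k; set e' := eta k.+1.
set D' := D k.+1; set D0 := D k; set E' := E k.+1; set E0 := E k.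
set V := deviation k; set rk := rho_ k.
by lra.
Qed.

(** The last iterate keeps the full weight [cweight t] and its distance to [u], which feeds the
    third estimate. *)
Lemma potential_last l :
  cweight t * (E t.+1 - dotp l (r t.+1)) + cweight t * deviation t
  + cweight t * (eta t + mu) / 2 * D t.+1 <= potential l t.
Proof.
have tt : (1 <= t <= t)%N by rewrite leqnn andbT ltnW.
have := ler_wpM2l (ltW (cweight_gt0 t)) (step_bound tt).
have h1 := mulr_ge0 (mulr_ge0 (ltW (cweight_gt0 t)) last_res_coef_ge0) (dotp_ge0 (r t.+1)).
have h2 := mulr_ge0 (dweight_ge0 tt) (dotp_ge0 (lam t.+1 - l)).
have := dualE l (cweight t) tt.
rewrite -[_ / (2 * rho_ t)](_ : dweight t = _); last by rewrite /dweight ltnn.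
by rewrite /potential; move: h1 h2; lra.
Qed.

Lemma potential_sum l n : (n < t)%N ->
  \sum_(1 <= k < n.+1)
    (xweight k.+1 * (E k.+1 - dotp l (r k.+1)) + cweight k * deviation k)
  + potential l n.+1 <= potential l 1.
Proof.
elim: n => [|n IH] nt; first by rewrite big_geq// add0r.
rewrite big_nat_recr//=; apply: le_trans (IH (ltnW nt)).
by rewrite -addrA lerD2l potential_decr.
Qed.

Lemma trajectory_bound l :
  \sum_(2 <= k < t.+1) xweight k * (real_objective g f (x k) - real_objective g f u
      - dotp l (A *m x k - b))
  + cweight t * (real_objective g f (x t.+1) - real_objective g f u
      - dotp l (A *m x t.+1 - b))
  + cweight t * (eta t + mu) / 2 * dotp (x t.+1 - u) (x t.+1 - u)
  + \sum_(1 <= k < t.+1) cweight k * deviation k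
  <= cweight 1 * (1 - theta) * (real_objective g f x1 - real_objective g f u
        + beta 1%N * dotp (A *m x1 - b) (A *m x1 - b)
        + mu / 2 * dotp (x1 - u) (x1 - u))
     + cweight 1 * eta 1%N / 2 * dotp (x1 - u) (x1 - u)
     + xweight 2 / (2 * rho_ 1%N) * dotp l l.
Proof.
have tE : t = t.-1.+1 by rewrite prednK// ltnW.
have t1t : (t.-1 < t)%N by rewrite [X in (_ < X)%N]tE.
have := potential_sum l t1t; rewrite -tE.
have := potential_last l.
have [x1E lam1 _ _] := iterates.
have -> : \sum_(2 <= k < t.+1) xweight k * (real_objective g f (x k)
     - real_objective g f u - dotp l (A *m x k - b))
  = \sum_(1 <= k < t) xweight k.+1 * (E k.+1 - dotp l (r k.+1)).
  rewrite big_add1/=; apply: eq_big_nat => k /andP[k1 kt].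
  by rewrite residualE//; exact: ltnW.
have -> : \sum_(1 <= k < t.+1) cweight k * deviation k
  = \sum_(1 <= k < t) cweight k * deviation k + cweight t * deviation t.
  by rewrite big_nat_recr//= ltnW.
rewrite big_split/= /potential lam1 sub0r dotpNl dotpNr opprK dotp0l subr0.
rewrite /dweight t_ge2 -!residualE; last 1 first.
- by rewrite /= leqnn.
rewrite /E /D x1E (residualE (k := 1%N))// x1E.
(* The potential at 1 carries [1 / 2 - theta] before beta_1 |r^1|^2 and the claim [1 - theta]; this
   is the difference. *)
have h : 0 <= cweight 1 * beta 1%N / 2 * dotp (A *m x1 - b) (A *m x1 - b).
  by rewrite mulr_ge0 ?dotp_ge0// divr_ge0// mulr_ge0 ?ltW ?cweight_gt0 ?beta_gt0.
by move: h; lra.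
Qed.

End Trajectory.

End StepSizes.

(** * Dependence on the sampled sets, and the three estimates in expectation *)

Lemma iterates_unique {R : realType} (M q : nat) (p_ : 'I_M -> nat)
    (f : 'cV[R]_(\sum_i p_ i) -> R) (g : forall i : 'I_M, 'cV[R]_(p_ i) -> \bar R)
    (A_ : forall i : 'I_M, 'M[R]_(q, p_ i)) (b : 'cV[R]_q)
    (beta rho eta : nat -> R) x1 t n S S' x x' lam lam' r r' :
  (forall i, proper_fun (g i)) -> (forall i, convex_efun (g i)) ->
  (forall k, (1 <= k)%N -> 0 < eta k) ->
  primal_dual_bcu f g A_ b beta rho eta x1 t S x lam r ->
  primal_dual_bcu f g A_ b beta rho eta x1 t S' x' lam' r' ->
  (forall j, (1 <= j <= n)%N -> S j = S' j) -> (n <= t)%N ->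
  [/\ x n.+1 = x' n.+1, lam n.+1 = lam' n.+1 & r n.+1 = r' n.+1].
Proof.
move=> gp gc eta0 [x1E l1 r1 it] [x1E' l1' r1' it'].
elim: n => [_ _|n IH SS nt]; first by rewrite x1E x1E' l1 l1' r1 r1'.
have [||xE lE rE] := IH; [by move=> j /andP[j1 jn]; apply: SS; rewrite j1 ltnW|exact: ltnW|].
have nt' : (1 <= n.+1 <= t)%N by [].
have [xmin xfix rS lS] := it _ nt'; have [xmin' xfix' rS' lS'] := it' _ nt'.
have Sn : S n.+1 = S' n.+1 by apply: SS; rewrite /= leqnn.
have xS : x n.+2 = x' n.+2.
  apply/mxcolP => i; have [iS|iS] := boolP (i \in S n.+1).
    have iS' : i \in S' n.+1 by rewrite -Sn.
    have h' := xmin' i iS'; rewrite -xE -lE -rE in h'.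
    exact: (argmin_unique gp gc (eta0 n.+1 _) (xmin i iS) h').
  by rewrite xfix// xfix' -?Sn// xE.
have rS2 : r n.+2 = r' n.+2 by rewrite rS rS' Sn xS xE rE.
by split; rewrite // lS lS' lE rS2.
Qed.

(** Some m-element set contains the block of the first coordinate; a nonzero vector supported on it
    gives 0 <= L times a positive norm. *)
Lemma partial_grad_lipschitz_ge0 {R : realType} (M m : nat) (p_ : 'I_M -> nat)
    (f : 'cV[R]_(\sum_i p_ i) -> R) (L : R) :
  (1 <= m <= M)%N -> (0 < \sum_i p_ i)%N ->
  (forall s : {set 'I_M}, #|s| = m -> partial_grad_lipschitz f s L) -> 0 <= L.
Proof.
move=> /andP[m0 mM] N0 lip; pose j := Ordinal N0.
have : (0 < #|[set s : {set 'I_M} | (#|s| == m) && (tagnat.sig1 j \in s)]%SET|)%N.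
  have := card_draws_mem (tagnat.sig1 j) m0.
  case: posnP => // ->; rewrite muln0 => /esym/eqP.
  by rewrite muln_eq0 -!leqn0 leqNgt m0/= leqNgt bin_gt0 mM.
move=> /card_gt0P[s]; rewrite inE => /andP[/eqP sm js].
pose v : 'cV[R]_(\sum_i p_ i) := block_restr s (delta_mx j 0).
have v0 : v != 0.
  apply/eqP => /colP/(_ j); rewrite /v /block_restr !mxE js !mxE tagnat.sig2K !eqxx.
  by move/eqP; rewrite oner_eq0.
have vgt0 : 0 < l2norm v by rewrite lt_def l2norm_eq0 v0 l2norm_ge0.
have := lip s sm 0 (delta_mx j 0); rewrite -/v => h.
by rewrite -(pmulr_lge0 _ vgt0); exact: le_trans (l2norm_ge0 _) h.
Qed.

Theorem theorem3p5 (R : realType) (M q : nat) (p_ : 'I_M -> nat)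
  (f : 'cV[R]_(\sum_i p_ i) -> R)
  (g : forall i : 'I_M, 'cV[R]_(p_ i) -> \bar R)
  (A_ : forall i : 'I_M, 'M[R]_(q, p_ i)) (b : 'cV[R]_q)
  (A : 'M[R]_(q, \sum_i p_ i)) (F : 'cV[R]_(\sum_i p_ i) -> \bar R)
  (m t : nat) (mu L rho theta k0 : R) (beta eta rho_ : nat -> R)
  (d : measure_display) (Omega : measurableType d) (P : probability Omega R)
  (S : nat -> Omega -> {set 'I_M})
  (x1 : 'cV[R]_(\sum_i p_ i)) (x : nat -> Omega -> 'cV[R]_(\sum_i p_ i))
  (lam r : nat -> Omega -> 'cV[R]_q)
  (xs : 'cV[R]_(\sum_i p_ i)) (ls : 'cV[R]_q)
  (gamma T : R) (xbar : Omega -> 'cV[R]_(\sum_i p_ i))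
  (Phi : 'cV[R]_(\sum_i p_ i) -> 'cV[R]_q -> \bar R)
  (A_def : A = \mxrow_i A_ i) (A_neq0 : A != 0)
  (F_def : F = objective f g)
  (f_convex : @convex_function R 'cV[R]_(\sum_i p_ i) setT f)
  (f_diff : forall z, differentiable (f : _ -> R^o) z)
  (g_proper : forall i, proper_fun (g i))
  (g_closed : forall i, lower_semicontinuous (g i))
  (g_convex : forall i, convex_efun (g i))
  (mu_gt0 : 0 < mu) (g_strong : strongly_convex_efun mu (separable_sum g))
  (m_bounds : (1 <= m <= M)%N)
  (f_lip : forall s : {set 'I_M}, #|s| = m -> partial_grad_lipschitz f s L)
  (kkt : kkt_point F A b xs ls)
  (theta_def : theta = m%:R / M%:R) (t_ge2 : (2 <= t)%N) (rho_ge1 : 1 <= rho)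
  (k0_def : k0 = 4 / theta + 2 * L / (theta * mu))
  (beta_def : forall k, (1 <= k)%N ->
    beta k = mu * (theta * k%:R + 2 + theta) / (2 * rho * spectral_norm A ^+ 2))
  (eta_def : forall k, (1 <= k)%N ->
    eta k = rho * beta k * spectral_norm A ^+ 2 + L)
  (rho_def : forall k, (1 <= k <= t.-1)%N ->
    rho_ k = theta * beta k / (6 - 5 * theta))
  (rho_t_def :
    rho_ t = (t%:R + k0 + 1) * rho_ t.-1 / (theta * (t%:R + k0 + 1) - 1))
  (S_sampling : uniform_sampling P m t S)
  (iterates : forall w, primal_dual_bcu f g A_ b beta rho_ eta x1 t
    (S ^~ w) (x ^~ w) (lam ^~ w) (r ^~ w))
  (gamma_def : gamma = Num.max (2 * l2norm ls) (1 + l2norm ls))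
  (T_def : T = (t%:R + k0 + 1)
    + \sum_(2 <= k < t.+1) (theta * (k%:R + k0 + 1) - 1))
  (xbar_def : forall w, xbar w = T^-1 *: ((t%:R + k0 + 1) *: x t.+1 w
    + \sum_(2 <= k < t.+1) (theta * (k%:R + k0 + 1) - 1) *: x k w))
  (Phi_def : Phi = phi3 F theta k0 mu (beta 1%N) (eta 1%N) (rho_ 1%N)
    x1 (A *m x1 - b)) :
  [/\ (`| \int[P]_w (F (xbar w) - F xs) |
       <= (T^-1)%:E
          * ereal_sup [set Phi xs l | l in [set l | (l2norm l <= gamma)%R]])%E,
      ('E_P[fun w => (l2norm (A *m xbar w - b))%R]
       <= ((T * Num.max 1 (l2norm ls))^-1)%:E
          * ereal_sup [set Phi xs l | l in [set l | (l2norm l <= gamma)%R]])%E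
    & ('E_P[fun w => (l2norm (x t.+1 w - xs) ^+ 2)%R]
       <= (2 / ((t%:R + k0 + 1)
            * ((rho - 1) * mu / (2 * rho) * (theta * t%:R + theta + 2)
               + 2 * mu + L)))%:E * Phi xs ls)%E].
Proof.
subst A F Phi.
set A : 'M[R]_(q, \sum_i p_ i) := \mxrow_i A_ i.
have [M_gt0 mR_gt0] : 0 < M%:R :> R /\ 0 < m%:R :> R.
  by rewrite !ltr0n; case/andP: m_bounds => m0 mM; split=> //; exact: leq_trans mM.
have theta_gt0 : 0 < theta by rewrite theta_def divr_gt0.
have theta_le1 : theta <= 1.
  by rewrite theta_def ler_pdivrMr// mul1r ler_nat; case/andP: m_bounds.
have N_gt0 : (0 < \sum_i p_ i)%N.
  rewrite lt0n; apply: contra A_neq0 => /eqP N0; apply/eqP/matrixP => i j.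
  by move: (ltn_ord j); rewrite [X in (_ < X)%N -> _]N0.
have L_ge0 := partial_grad_lipschitz_ge0 m_bounds N_gt0 f_lip.
have sA : 0 < spectral_norm A by exact: spectral_norm_gt0.
have n2_gt0 : 0 < spectral_norm A ^+ 2 by rewrite exprn_gt0.
have A_le := dotp_mulmx_le A.
have eta_gt0 := eta_gt0 theta_gt0 theta_le1 mu_gt0 L_ge0 rho_ge1 n2_gt0 beta_def eta_def.
have cw_gt0 := cweight_gt0 theta_gt0 theta_le1 mu_gt0 L_ge0 rho_ge1 n2_gt0 k0_def.
have xw_gt0 := xweight_gt0 theta_gt0 theta_le1 mu_gt0 L_ge0 rho_ge1 n2_gt0 k0_def.
have [[v v_sub /eqP]] := kkt; rewrite eq_sym subr_eq0 => /eqP v_ls Axs.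
have xs_dom := subdiff_dom g_proper v_sub.
pose obj := real_objective g f.
have tt : (1 <= t)%N by exact: ltnW.
have f_lip_S w k : (1 <= k <= t)%N -> partial_grad_lipschitz f (S k w) L.
  by move=> kt; have [Sm _ _ _] := S_sampling k kt; exact: f_lip.
have adapted n w w' : (n <= t)%N -> same_sets S n w w' ->
    [/\ x n.+1 w = x n.+1 w', lam n.+1 w = lam n.+1 w' & r n.+1 w = r n.+1 w'].
  by move=> nt ss; exact: iterates_unique g_proper g_convex eta_gt0
    (iterates w) (iterates w') ss nt.
have x_adapted k w w' : (1 <= k <= t.+1)%N -> same_sets S t w w' -> x k w = x k w'.
  case: k => // k /andP[_ kt] ss; have [] := adapted k w w' _ _ => //.
  by move=> j /andP[j1 jk]; apply: ss; rewrite j1 (leq_trans jk).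
have [W [c [c_ge0 intE avg_sel]]] := sampling_average m_bounds S_sampling.
(* Real-valued stand-in for the expectation: sums over [W] need no integrability argument. *)
pose avg (G : Omega -> R) := c * \sum_(w <- W) G w.
have avg_le G G' : (forall w, G w <= G' w) -> avg G <= avg G'.
  by move=> h; rewrite ler_wpM2l// ler_sum.
have avgD G G' : avg (fun w => G w + G' w) = avg G + avg G'.
  by rewrite /avg big_split mulrDr.
have avgZ a G : avg (fun w => a * G w) = a * avg G.
  by rewrite /avg -mulr_sumr mulrCA.
have avg_cst a : avg (fun=> a) = a.
  have := intE (fun=> a) (fun _ _ _ => erefl).
  rewrite (_ : (\int[P]__ _)%E = a%:E) => [[]//|].
  by rewrite integral_cst// [X in (_ * X)%E](probability_setT P) mule1.
have avg_sum (s : seq nat) (G : nat -> Omega -> R) :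
    avg (fun w => \sum_(k <- s) G k w) = \sum_(k <- s) avg (G k).
  by rewrite /avg exchange_big/= mulr_sumr.
pose dev w k := deviation theta mu beta f g A_ xs (S ^~ w) (x ^~ w) (lam ^~ w) (r ^~ w) k.
have avg_dev k : (1 <= k <= t)%N -> avg (dev^~ k) = 0.
  move=> kt; pose Z i w := block_gain g mu f A_ xs (x k w) (lam k w - beta k *: r k w) i.
  have Z_past i w w' : same_sets S k.-1 w w' -> Z i w = Z i w'.
    move=> ss; have k1 : k = k.-1.+1 by rewrite prednK//; case/andP: kt.
    have [|] := adapted k.-1 w w' _ ss; first by case/andP: kt => _; exact/leq_trans/leq_pred.
    by rewrite -k1 /Z => -> -> ->.
  have devE w : dev w k = \sum_i (i \in S k w)%:R * Z i w - theta * \sum_i Z i w.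
    congr (_ - _); rewrite big_mkcond/=; apply: eq_bigr => i _.
    by case: ifP => _; rewrite ?mul1r ?mul0r.
  rewrite /avg (eq_bigr _ (fun w _ => devE w)) sumrB exchange_big/=.
  rewrite (eq_bigr (fun i => theta * \sum_(w <- W) Z i w)) => [|i _]; last first.
    by rewrite (avg_sel k i (Z i) kt (Z_past i)) theta_def.
  by rewrite -mulr_sumr -[X in _ - X]mulr_sumr [in X in _ - X]exchange_big/= subrr mulr0.
pose r1 := A *m x1 - b.
(* [C1 + C2 * dotp l l] is the real value of [Phi xs l] outside the degenerate case treated
   below. *)
pose C1 := (1 - theta) * (k0 + 2) * (obj x1 - obj xs + beta 1%N * dotp r1 r1
    + mu / 2 * dotp (x1 - xs) (x1 - xs))
  + eta 1%N * (k0 + 2) / 2 * dotp (x1 - xs) (x1 - xs).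
pose C2 := (theta * (k0 + 3) - 1) / (2 * rho_ 1%N).
pose D w := dotp (x t.+1 w - xs) (x t.+1 w - xs).
pose e (l : 'cV[R]_q) z := obj z - obj xs - dotp l (A *m z - b).
have cw1 : cweight k0 1 = k0 + 2 by rewrite /cweight; ring.
have xw2 : xweight theta k0 2 = theta * (k0 + 3) - 1 by rewrite /xweight /cweight; ring.
(* The multiplier may depend on w, because the deviations do not involve it. *)
have avg_bound (l : Omega -> 'cV[R]_q) :
    avg (fun w => \sum_(2 <= k < t.+1) xweight theta k0 k * e (l w) (x k w)
      + cweight k0 t * e (l w) (x t.+1 w) + cweight k0 t * (eta t + mu) / 2 * D w)
    <= avg (fun w => C1 + C2 * dotp (l w) (l w)).
  have avg0 : avg (fun w => \sum_(1 <= k < t.+1) cweight k0 k * dev w k) = 0.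
    rewrite avg_sum big_nat big1// => k kt.
    by rewrite avgZ avg_dev ?mulr0.
  rewrite -[leLHS]addr0 -[X in _ + X <= _]avg0 -avgD; apply: avg_le => w.
  have h := trajectory_bound theta_gt0 theta_le1 mu_gt0 L_ge0 rho_ge1 n2_gt0 t_ge2
    k0_def beta_def eta_def rho_def rho_t_def f_convex f_diff g_proper g_convex
    g_strong (f_lip_S w) A_le Axs xs_dom (iterates w) (l w).
  rewrite cw1 xw2 in h; cbv beta; apply: (le_trans h).
  by rewrite le_eqVlt; apply/orP; left; apply/eqP; rewrite /C1 /C2 /r1 -/obj; ring.
have D_ge0 w : 0 <= D w by exact: dotp_ge0.
have cw_eta w : 0 <= cweight k0 t * (eta t + mu) / 2 * D w.
  rewrite mulr_ge0// divr_ge0// mulr_ge0//; first exact: ltW.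
  by rewrite addr_ge0// ltW// eta_gt0.
have T_gt0 : 0 < T.
  rewrite T_def ltr_pwDl//; first exact: cw_gt0.
  by apply: sumr_ge0 => k _; exact/ltW/xw_gt0.
set Phi := phi3 _ _ _ _ _ _ _ x1 _.
pose K := (rho - 1) * mu / (2 * rho) * (theta * t%:R + theta + 2) + 2 * mu + L.
have rho_gt0 : 0 < rho by exact: lt_le_trans rho_ge1.
have B_gt0 : 0 < theta * t%:R + theta + 2.
  by rewrite addr_gt0// addr_gt0// mulr_gt0// ltr0n.
have K_gt0 : 0 < K.
  rewrite /K -addrA; apply: ltr_wpDl; last by apply: ltr_pwDl => //; exact: mulr_gt0.
  apply: mulr_ge0; last exact: ltW.
  apply: divr_ge0; last by apply: mulr_ge0 => //; exact: ltW.
  by apply: mulr_ge0; [rewrite subr_ge0|exact: ltW].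
(* In the third estimate one [mu] comes from the trajectory bound and one from the growth of the
   Lagrangian at [xs]. *)
have K_le : K <= eta t + 2 * mu.
  rewrite /K eta_def// beta_def// -subr_ge0.
  have -> : rho * (mu * (theta * t%:R + 2 + theta) / (2 * rho * spectral_norm A ^+ 2))
      * spectral_norm A ^+ 2 + L + 2 * mu
      - ((rho - 1) * mu / (2 * rho) * (theta * t%:R + theta + 2) + 2 * mu + L)
    = mu / (2 * rho) * (theta * t%:R + theta + 2).
    by field; rewrite !gt_eqF.
  by rewrite mulr_ge0// ?ltW// divr_gt0// mulr_gt0.
have cK_gt0 : 0 < 2 / (cweight k0 t * K) by rewrite divr_gt0// mulr_gt0.
rewrite -/(cweight k0 t) -/K.
set sup := ereal_sup _.
have sup_ub l : l2norm l <= gamma -> (Phi xs l <= sup)%E.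
  by move=> lg; apply: ereal_sup_ubound; exists l.
have gamma_ge0 : 0 <= gamma.
  by rewrite gamma_def le_max addr_ge0 ?l2norm_ge0 ?orbT.
(* If F(x^1) is infinite and theta < 1, then [Phi] is +oo and all three bounds are trivial. If theta
   = 1, the first iteration selects every block, so the iterates are in the domain from index 2
   on. *)
have [good|bad] := pselect (block_dom g x1 \/ theta = 1); last first.
  have th1 : theta < 1.
    by rewrite lt_neqAle theta_le1 andbT; apply/eqP => th; apply: bad; right.
  have Fx1 : objective f g x1 = +oo%E.
    apply: contrapT => /eqP Fx1; apply: bad; left.
    by apply/(objective_fin_num f); rewrite fin_numE objective_neqNy.
  have PhiE l : Phi xs l = +oo%E.
    rewrite /Phi /phi3 Fx1 (objectiveE f xs_dom) !addye// gt0_muley ?addye//.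
    rewrite lte_fin mulr_gt0 ?subr_gt0// -cw1; exact: cw_gt0.
  have supE : sup = +oo%E.
    apply/eqP; rewrite -leye_eq -(PhiE 0); apply: sup_ub.
    by rewrite l2norm0.
  rewrite supE PhiE !gt0_muley ?leey// lte_fin ?invr_gt0// mulr_gt0//.
  by rewrite lt_max ltr01.
have x_dom k w : (2 <= k <= t.+1)%N -> block_dom g (x k w).
  case: k => [//|[//|k]]; rewrite !ltnS /=.
  elim: k => [|k IH] kt; apply: (iterate_dom_step g_proper (iterates w)) => //.
    case: good => [dx1|th1]; [left|right].
      by have [-> _ _ _] := iterates w.
    have [Sm _ _ _] := S_sampling 1%N kt.
    apply/eqP; rewrite eqEcard finset.subsetT cardsT card_ord Sm /=.
    move: th1; rewrite theta_def => /eqP.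
    by rewrite -(inj_eq (mulIf (lt0r_neq0 M_gt0))) divfK ?lt0r_neq0// mul1r eqr_nat => /eqP ->.
  by left; exact/IH/ltnW.
have PhiE l : Phi xs l = (C1 + C2 * dotp l l)%:E.
  rewrite /Phi /phi3 !sqr_l2norm /C1 -/r1 -/C2.
  case: good => [dx1|->].
    by rewrite (objectiveE f dx1) (objectiveE f xs_dom).
  by rewrite subrr !mul0r mul0e !add0e add0r -EFinD.
have t1t : (2 <= t.+1 <= t.+1)%N by rewrite leqnn andbT; exact: tt.
have jen w : [/\ 0 < T, block_dom g (xbar w)
    & T * obj (xbar w) <= cweight k0 t * obj (x t.+1 w)
        + \sum_(2 <= k < t.+1) xweight theta k0 k * obj (x k w)].
  rewrite T_def xbar_def T_def.
  apply: (jensen f_convex g_proper g_convex mu_gt0 g_strong (cw_gt0 t)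
    (x_dom t.+1 w t1t)).
  move=> k; rewrite mem_index_iota => /andP[k2 kt]; split; first exact: xw_gt0.
  by apply: x_dom; rewrite k2 ltnW.
have xbar_dom w : block_dom g (xbar w) by have [] := jen w.
(* The Lagrangian gap is convex: Jensen handles [obj], and the residual part is affine. *)
have xbar_le l w : T * e l (xbar w) <= \sum_(2 <= k < t.+1) xweight theta k0 k * e l (x k w)
      + cweight k0 t * e l (x t.+1 w).
  have [_ _ h] := jen w.
  pose a := obj xs - dotp l b.
  have eE z : e l z = obj z - a - dotp l (A *m z).
    by rewrite /e dotpDr dotpNr /a; ring.
  have AT : T * dotp l (A *m xbar w) = cweight k0 t * dotp l (A *m x t.+1 w)
      + \sum_(2 <= k < t.+1) xweight theta k0 k * dotp l (A *m x k w).
    rewrite xbar_def -scalemxAr dotpZr mulrA divff ?gt_eqF// mul1r.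
    rewrite mulmxDr dotpDr -scalemxAr dotpZr mulmx_sumr dotp_sumr.
    by congr (_ + _); apply: eq_bigr => k _; rewrite -scalemxAr dotpZr.
  have TE : T = cweight k0 t + \sum_(2 <= k < t.+1) xweight theta k0 k by rewrite T_def.
  have -> : \sum_(2 <= k < t.+1) xweight theta k0 k * e l (x k w)
     = \sum_(2 <= k < t.+1) xweight theta k0 k * obj (x k w)
       - (\sum_(2 <= k < t.+1) xweight theta k0 k) * a
       - \sum_(2 <= k < t.+1) xweight theta k0 k * dotp l (A *m x k w).
    by rewrite mulr_suml -!sumrB; apply: eq_bigr => k _; rewrite eE; ring.
  rewrite !eE mulrBr AT mulrBr [in X in _ - X - _]TE; move: h.
  set s1 := \sum_(_ <= _ < _) _; set s2 := \sum_(_ <= _ < _) _.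
  set s3 := \sum_(_ <= _ < _) _.
  by move=> h; rewrite -subr_ge0 in h; rewrite -subr_ge0;
    apply: (le_trans h); rewrite le_eqVlt; apply/orP; left; apply/eqP; ring.
have main_bound (l : Omega -> 'cV[R]_q) :
    T * avg (fun w => e (l w) (xbar w)) <= avg (fun w => C1 + C2 * dotp (l w) (l w)).
  apply: le_trans (avg_bound l); rewrite -avgZ; apply: avg_le => w.
  by apply: (le_trans (xbar_le (l w) w)); rewrite lerDl cw_eta.
(* The subgradient at [xs] is [A^T *m ls], so the Lagrangian with multiplier [ls] is minimal at [xs]
   with quadratic growth. *)
have growth z : block_dom g z -> mu / 2 * dotp (z - xs) (z - xs) <= e ls z.
  move=> dz; have := subdiff_growth f_convex g_proper g_convex mu_gt0 g_strong v_sub dz.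
  by rewrite v_ls dotp_trmx mulmxBr -/A Axs /e -/obj; lra.
have cwt : 0 < cweight k0 t := cw_gt0 t.
have bound3 : avg D <= 2 / (cweight k0 t * K) * (C1 + C2 * dotp ls ls).
  rewrite mulrAC ler_pdivlMr; last exact: mulr_gt0.
  have : avg (fun w => cweight k0 t * K / 2 * D w) <= C1 + C2 * dotp ls ls.
    rewrite -(avg_cst (C1 + C2 * dotp ls ls)).
    apply: le_trans (avg_bound (fun=> ls)); apply: avg_le => w.
    have h1 : 0 <= \sum_(2 <= k < t.+1) xweight theta k0 k * e ls (x k w).
      rewrite big_nat sumr_ge0// => k /andP[k2 kt].
      apply: mulr_ge0; first exact: ltW.
      have kt1 : (2 <= k <= t.+1)%N by rewrite k2 ltnW.
      apply: le_trans (growth _ (x_dom k w kt1)).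
      by rewrite mulr_ge0 ?dotp_ge0// divr_ge0// ltW.
    have h2 := ler_wpM2l (ltW cwt) (growth _ (x_dom t.+1 w t1t)).
    have h3 := ler_wpM2r (D_ge0 w) (ler_wpM2l (ltW cwt) K_le).
    by move: h1 h2 h3; rewrite -/(D w); lra.
  by rewrite avgZ; lra.
pose rn w := l2norm (A *m xbar w - b).
pose ex w := obj (xbar w) - obj xs.
have t1 : (1 <= t.+1 <= t.+1)%N by rewrite leqnn.
have xbar_adapted w w' : same_sets S t w w' -> xbar w = xbar w'.
  move=> ss; rewrite !xbar_def (x_adapted t.+1 w w' t1 ss).
  congr (_ *: (_ + _)); apply: eq_big_nat => k /andP[k2 kt].
  by rewrite (x_adapted k w w')// (ltnW k2) ltnW.
have int_ex : (\int[P]_w (objective f g (xbar w) - objective f g xs))%E = (avg ex)%:E.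
  have ex_adapted w w' : same_sets S t w w' -> ex w = ex w'.
    by move=> ss; rewrite /ex (xbar_adapted _ _ ss).
  rewrite -(intE ex ex_adapted).
  by apply: eq_integral => w _; rewrite (objectiveE f (xbar_dom w)) (objectiveE f xs_dom).
have int_rn : ('E_P[rn] = (avg rn)%:E)%E.
  have rn_adapted w w' : same_sets S t w w' -> rn w = rn w'.
    by move=> ss; rewrite /rn (xbar_adapted _ _ ss).
  by rewrite unlock -(intE rn rn_adapted).
have int_D : ('E_P[fun w => (l2norm (x t.+1 w - xs) ^+ 2)%R] = (avg D)%:E)%E.
  have D_adapted w w' : same_sets S t w w' -> D w = D w'.
    by move=> ss; rewrite /D (x_adapted t.+1 w w' t1 ss).
  rewrite unlock -(intE D D_adapted).
  by apply: eq_integral => w _; rewrite sqr_l2norm.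
rewrite int_ex int_rn int_D PhiE -EFinM lee_fin bound3.
pose mx := Num.max 1 (l2norm ls).
have mx_gt0 : 0 < mx by rewrite lt_max ltr01.
have rn_ge0 : 0 <= avg rn.
  by rewrite -[leLHS](avg_cst 0); apply: avg_le => w; exact: l2norm_ge0.
(* Stated for any real upper bound B of [Phi] on the ball, as the supremum is extended-valued. *)
have bounds B : (forall l : 'cV[R]_q, l2norm l <= gamma -> C1 + C2 * dotp l l <= B) ->
    `|avg ex| <= T^-1 * B /\ avg rn <= (T * mx)^-1 * B.
  move=> CB.
  have ub : avg ex <= T^-1 * B.
    rewrite mulrC ler_pdivlMr// mulrC.
    have := main_bound (fun=> 0).
    rewrite (avg_cst (C1 + C2 * dotp (0 : 'cV[R]_q) (0 : 'cV[R]_q))).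
    have -> : avg (fun w => e 0 (xbar w)) = avg ex.
      by rewrite /avg; congr (_ * _); apply: eq_bigr => w _; rewrite /e dotp0l subr0.
    by move=> h; apply: (le_trans h (CB 0 _)); rewrite l2norm0.
  (* The multiplier of norm at most [gamma] that best penalises the residual. Division by 0 yields
     0, so it vanishes with the residual. *)
  pose lw w : 'cV[R]_q := (- (gamma / rn w)) *: (A *m xbar w - b).
  have lw_le w : l2norm (lw w) <= gamma.
    rewrite l2normZ normrN ger0_norm; last by rewrite divr_ge0 ?l2norm_ge0.
    rewrite -/(rn w); have [->|r0] := eqVneq (rn w) 0; first by rewrite mulr0.
    by rewrite divfK.
  have lwE w : e (lw w) (xbar w) = ex w + gamma * rn w.
    rewrite /e /lw dotpZl -sqr_l2norm -/(rn w) /ex mulNr opprK; congr (_ + _).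
    have [->|r0] := eqVneq (rn w) 0; first by rewrite expr0n !mulr0.
    by field.
  have h1 : T * (avg ex + gamma * avg rn) <= B.
    rewrite -avgZ -avgD -(avg_cst B).
    have -> : avg (fun w => ex w + gamma * rn w) = avg (fun w => e (lw w) (xbar w)).
      by rewrite /avg; congr (_ * _); apply: eq_bigr => w _; rewrite lwE.
    by apply: (le_trans (main_bound lw)); apply: avg_le => w; exact: CB.
  have h2 : - (l2norm ls * avg rn) <= avg ex.
    rewrite -mulNr -avgZ; apply: avg_le => w.
    have := growth _ (xbar_dom w); rewrite /e -/(ex w) => h.
    have := abs_dotp_le ls (A *m xbar w - b); rewrite -/(rn w) ler_norml => /andP[h3 _].
    have := mulr_ge0 (divr_ge0 (ltW mu_gt0) (ler0n R 2)) (dotp_ge0 (xbar w - xs)).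
    by move: h h3; set a := dotp ls _; lra.
  (* This is what [gamma] is chosen for: after [h2] is used, a multiple max(1, |ls|) of the mean
     residual remains. *)
  have mx_le : mx <= gamma - l2norm ls.
    rewrite lerBrDr gamma_def le_max /mx.
    have [ls1|/ltW ls1] := leP 1 (l2norm ls); apply/orP.
      by left; rewrite mulr_natl mulr2n.
    by right.
  have h4 : avg rn <= (T * mx)^-1 * B.
    rewrite mulrC ler_pdivlMr ?mulr_gt0//.
    apply: le_trans h1; rewrite mulrCA ler_pM2l//.
    have := ler_wpM2r rn_ge0 mx_le; lra.
  split=> //; rewrite ler_norml ub andbT.
  (* The residual bound fed back into [h2] gives the lower bound on the objective gap. *)
  have h5 : l2norm ls * avg rn <= mx * ((T * mx)^-1 * B).
    by apply: ler_pM => //; [exact: l2norm_ge0|rewrite le_max lexx orbT].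
  have h6 : mx * ((T * mx)^-1 * B) = T^-1 * B by field; rewrite !gt_eqF.
  by move: h2 h5; rewrite h6; lra.
have Phi_fin (l : 'cV[R]_q) : l2norm l <= gamma -> ((C1 + C2 * dotp l l)%:E <= sup)%E.
  by move=> lg; rewrite -PhiE; exact: sup_ub.
move: Phi_fin; case: sup {sup_ub} => [B||] CB.
- have [] := bounds B; first by move=> l lg; have := CB l lg; rewrite lee_fin.
  by move=> h1 h2; split=> //; rewrite -EFinM lee_fin.
- by rewrite !gt0_muley ?lte_fin ?invr_gt0 ?mulr_gt0//; split; rewrite ?leey.
- by have := CB 0; rewrite l2norm0 => /(_ gamma_ge0).
Qed.
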